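(* Let $n\ge 2$, let $\delta>0$, let $A\subset\mathbb{B}^n$ be a non-degenerate continuum, and let $Q:\mathbb{B}^n\to[0,\infty]$ be a Lebesgue measurable function with $Q\in L^1(\mathbb{B}^n)$. Let $\mathfrak{S}_{\delta,A,Q}$ be the family of all open, discrete and closed mappings $f$ of $\mathbb{B}^n$ onto itself that satisfy the inverse Poletsky inequality with majorant $Q$ and for which $\mathrm{dist}(f^{-1}(A),\partial\mathbb{B}^n)\ge\delta$. Then every $f\in\mathfrak{S}_{\delta,A,Q}$ has a continuous extension $f:\overline{\mathbb{B}^n}\to\overline{\mathbb{B}^n}$. Moreover, there is a constant $C_n>0$ depending only on $n$ such that for every $x_0\in\partial\mathbb{B}^n$ there is $r_0=r_0(x_0)>0$ (not depending on $f\in\mathfrak{S}_{\delta,A,Q}$) such that, for every $f\in\mathfrak{S}_{\delta,A,Q}$ (extended continuously to $\overline{\mathbb{B}^n}$) and every $x\in B(x_0,r_0)\cap\overline{\mathbb{B}^n}$, $$|f(x)-f(x_0)|\le\frac{C_n\,(\|Q\|_1)^{1/n}}{\log^{1/n}\left(1+\frac{r_0}{|x-x_0|}\right)},$$ where $\|Q\|_1$ denotes the $L^1$-norm of $Q$ in $L^1(\mathbb{B}^n)$, and for $x=x_0$ the right-hand side is understood as $0$.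
   Context: Notation: $B(x_0,r)=\{x\in\mathbb{R}^n:|x-x_0|<r\}$, $\mathbb{B}^n=B(0,1)$, $\mathrm{dist}(A,B)=\inf_{x\in A,\,y\in B}|x-y|$; $m$ is Lebesgue measure in $\mathbb{R}^n$. A continuum is a compact connected set; it is non-degenerate if it has more than one point. Mappings are continuous. A Borel function $\rho:\mathbb{R}^n\to[0,\infty]$ is admissible for a family $\Gamma$ of paths in $\mathbb{R}^n$, written $\rho\in\mathrm{adm}\,\Gamma$, if $\int_\gamma\rho(x)\,|dx|\ge 1$ for every locally rectifiable path $\gamma\in\Gamma$. The modulus of $\Gamma$ is $M(\Gamma)=\inf_{\rho\in\mathrm{adm}\,\Gamma}\int_{\mathbb{R}^n}\rho^n(x)\,dm(x)$. A mapping $f$ of a domain $D\subset\mathbb{R}^n$ into $\mathbb{R}^n$ satisfies the inverse Poletsky inequality with majorant $Q$ if $$M(\Gamma)\le\int_{f(D)}Q(y)\,\rho_*^n(y)\,dm(y)$$ for every family $\Gamma$ of (locally rectifiable) paths in $D$ and every $\rho_*\in\mathrm{adm}\,f(\Gamma)$, where $f(\Gamma)=\{f\circ\gamma:\gamma\in\Gamma\}$. Here $D=f(D)=\mathbb{B}^n$. A mapping $f$ is discrete if $f^{-1}(y)$ consists of isolated points for every $y\in\mathbb{R}^n$; open if the image of every open subset of $D$ is open in $\mathbb{R}^n$; a mapping between domains $D$ and $D'$ is closed if $f(E)$ is closed in $D'$ for every set $E\subset D$ closed in $D$. *)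

(* Defs.v *)
From HB Require Import structures.
From mathcomp Require Import all_boot all_order all_algebra.
From mathcomp Require Import all_classical all_reals all_analysis.
From mathcomp Require Import measurable_realfun.

Set Implicit Arguments.
Unset Strict Implicit.
Unset Printing Implicit Defensive.

Import Order.TTheory GRing.Theory Num.Def Num.Theory.
Import numFieldNormedType.Exports.

Local Open Scope classical_set_scope.
Local Open Scope ring_scope.

(* R^n is 'rV[R]_n. The library's norm on it is the sup norm; it induces the
   same topology as the Euclidean norm, but metric quantities use [enorm]. *)

Section EuclideanSpace.
Context {R : realType} {n : nat}.
Implicit Types (x : 'rV[R]_n) (A B D E : set 'rV[R]_n).

Definition enorm x : R := Num.sqrt (\sum_(i < n) x ord0 i ^+ 2).

Definition eball x (r : R) : set 'rV[R]_n := [set y | enorm (y - x) < r].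

Definition unit_ball : set 'rV[R]_n := eball 0 1.

Definition frontier A : set 'rV[R]_n := closure A `\` A°.

Definition edist A B : \bar R :=
  ereal_inf [set (enorm (p.1 - p.2))%:E | p in A `*` B].

Definition nondegenerate_continuum A : Prop :=
  [/\ compact A, connected A & exists x y, [/\ A x, A y & x <> y]].

End EuclideanSpace.

Section LebesgueMeasure.
Context {R : realType} (n : nat).

(* [None] is the empty box, so that a sequence of boxes may be finite; without
   it the empty set would not be null in dimension 0. *)
Definition box (p : option ('rV[R]_n * 'rV[R]_n)) : set 'rV[R]_n :=
  if p is Some (a, b) then [set x | forall i, a ord0 i <= x ord0 i <= b ord0 i]
  else set0.

Definition box_volume (p : option ('rV[R]_n * 'rV[R]_n)) : R :=
  if p is Some (a, b) then \prod_(i < n) Num.max 0 (b ord0 i - a ord0 i)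
  else 0.

Definition box_cover (A : set 'rV[R]_n) :
    set (nat -> option ('rV[R]_n * 'rV[R]_n)) :=
  [set F | A `<=` \bigcup_k box (F k)].

Definition lebesgue_outer (A : set 'rV[R]_n) : \bar R :=
  ereal_inf [set (\sum_(0 <= k <oo) (box_volume (F k))%:E)%E
            | F in box_cover A].

Local Open Scope ereal_scope.

Lemma box_volume_ge0 p : 0 <= (box_volume p)%:E.
Proof.
rewrite lee_fin; case: p => [[a b]|//].
by apply: prodr_ge0 => i _; rewrite le_max lexx.
Qed.

Lemma lebesgue_outer_ge0 A : 0 <= lebesgue_outer A.
Proof.
apply: le_ereal_inf_tmp => _ [F _ <-].
by apply: nneseries_ge0 => k _ _; exact: box_volume_ge0.
Qed.

Lemma le_lebesgue_outer :
  {homo lebesgue_outer : A B / A `<=` B >-> A <= B}.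
Proof.
move=> A B AB; apply: ereal_inf_le_tmp => _ [F BF <-].
by exists F => //; exact: subset_trans AB BF.
Qed.

Lemma lebesgue_outer_sigma_subadditive : sigma_subadditive lebesgue_outer.
Proof.
move=> A; have [[i ioo]|] := pselect (exists i, lebesgue_outer (A i) = +oo).
  rewrite (eseries_pinfty _ _ ioo) ?leey// => k _.
  by rewrite -ltNye (lt_le_trans _ (lebesgue_outer_ge0 _)).
rewrite -forallNE => Aoo.
apply/lee_addgt0Pr => _/posnumP[e].
rewrite (le_trans _ (epsilon_trick _ _ _))//; last first.
  by move=> k; exact: lebesgue_outer_ge0.
pose P k F := box_cover (A k) F /\
  \sum_(0 <= j <oo) (box_volume (F j))%:E
    <= lebesgue_outer (A k) + (e%:num / (2 ^ k.+1)%:R)%:E.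
have [G PG] : {G & forall k, P k (G k)}.
  apply: (@choice _ _ P) => k; rewrite /P.
  have fk : lebesgue_outer (A k) \is a fin_num.
    by rewrite ge0_fin_numE ?lebesgue_outer_ge0// ltey; apply/eqP/Aoo.
  have e0 : (0 < e%:num / (2 ^ k.+1)%:R)%R by [].
  have [_ [F AF <-] Fe] := lb_ereal_inf_adherent e0 fk.
  by exists F; split => //; exact: ltW.
pose vol := fun p => (box_volume p)%:E : \bar R.
have vol0 (p : option ('rV[R]_n * 'rV[R]_n)) : 0 <= vol p by exact: box_volume_ge0.
apply: (@le_trans _ _ (\esum_(i in setT) (vol \o uncurry G) i)).
  apply: ereal_inf_lbound => /=.
  have /card_esym/ppcard_eqP[f] := card_nat2.
  exists (uncurry G \o f).
    move=> x [k _ /(PG k).1 [j _ Gx]]; exists (f^-1%FUN (k, j)) => //=.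
    by rewrite invK ?inE.
  rewrite -(esum_pred_image (vol \o uncurry G) _ xpredT) ?[fun=> _]set_true//.
    by rewrite image_eq.
  by move=> *; exact: vol0.
rewrite (_ : esum _ _ = \sum_(k <oo) \sum_(j <oo) vol (G k j)); last first.
  pose J : nat -> set (nat * nat) := fun i => [set (i, j) | j in setT].
  rewrite (_ : setT = \bigcup_k J k); last first.
    by rewrite predeqE => -[a b]; split => // _; exists a => //; exists b.
  rewrite esum_bigcupT /=; last 2 first.
  - apply/trivIsetP => i j _ _ ij.
    rewrite predeqE => -[p q] /=; split => //= -[] [_] _ [<-{p} _].
    by move=> [q' _] [] /esym/eqP; rewrite (negbTE ij).
  - by move=> *; exact: vol0.
  rewrite nneseries_esumT; last first.
    by move=> k; apply: nneseries_ge0 => j _ _; exact: vol0.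
  apply: eq_esum => k _.
  rewrite nneseries_esumT; last by move=> *; exact: vol0.
  by rewrite (_ : J k = pair k @` setT)// esum_image//= => ? ? _ _ [].
apply: lee_nneseries => [k _ _|k _]; last exact: (PG k).2.
by apply: nneseries_ge0 => j _ _; exact: vol0.
Qed.

Lemma lebesgue_outer0 : lebesgue_outer set0 = 0.
Proof.
apply/eqP; rewrite eq_le lebesgue_outer_ge0 andbT.
apply: ereal_inf_lbound; exists (fun=> None) => //.
by apply: eseries0.
Qed.

HB.instance Definition _ := isOuterMeasure.Build R 'rV[R]_n lebesgue_outer
  lebesgue_outer0 lebesgue_outer_ge0 le_lebesgue_outer
  lebesgue_outer_sigma_subadditive.

(* Lebesgue measure on R^n: [caratheodory_type lebesgue_outer] is R^n with the
   sigma-algebra of (Caratheodory) Lebesgue measurable sets. *)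
Definition leb : set (caratheodory_type lebesgue_outer) -> \bar R :=
  lebesgue_outer.

HB.instance Definition _ :=
  isMeasure.Build _ (caratheodory_type lebesgue_outer) R leb
    (@caratheodory_measure0 _ _ lebesgue_outer)
    (@caratheodory_measure_ge0 _ _ lebesgue_outer)
    (@caratheodory_measure_sigma_additive _ _ lebesgue_outer).

End LebesgueMeasure.

Section Modulus.
Context {R : realType} {n : nat}.
Implicit Types (g : R -> 'rV[R]_n) (rho Q : 'rV[R]_n -> \bar R).
Local Open Scope ereal_scope.

(* A path is a continuous map of an arbitrary (open, half-open or closed,
   possibly unbounded) nonempty interval; values of [path_map] outside
   [path_dom] are irrelevant. *)
Record path := Path { path_dom : interval R; path_map : R -> 'rV[R]_n }.

Definition borel_fun rho : Prop :=
  measurable_fun setT (rho : g_sigma_algebraType (@open 'rV[R]_n) -> \bar R).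

Definition is_path (gamma : path) : Prop :=
  [set` path_dom gamma] !=set0 /\
  {within [set` path_dom gamma], continuous (path_map gamma)}.

Definition path_in (D : set 'rV[R]_n) (gamma : path) : Prop :=
  is_path gamma /\
  forall t, t \in path_dom gamma -> D (path_map gamma t).

Definition path_comp (f : 'rV[R]_n -> 'rV[R]_n) (gamma : path) : path :=
  Path (path_dom gamma) (f \o path_map gamma).

(* The Euclidean analogue of the library's [variation]. *)
Definition polygonal_length (a b : R) g (s : seq R) : R :=
  let F := g \o nth b (a :: s) in
  (\sum_(0 <= k < size s) enorm (F k.+1 - F k))%R.

Definition curve_length (a b : R) g : \bar R :=
  ereal_sup [set (polygonal_length a b g s)%:E | s in itv_partition a b].

(* The map g° with g = g° \o (fun t => curve_length a t g) on [a, b]; the choice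
   of t does not matter as g is constant where its length function is. *)
Definition arclength_param (a b : R) g (u : R) : 'rV[R]_n :=
  g (get [set t | t \in `[a, b]%R /\ curve_length a t g = u%:E]).

(* Meaningful for g rectifiable on [a, b]. *)
Definition arclength_integral rho (a b : R) g : \bar R :=
  \int[lebesgue_measure]_(u in `[0%R, fine (curve_length a b g)])
    rho (arclength_param a b g u).

Definition closed_subinterval (I : interval R) (p : R * R) : Prop :=
  [/\ p.1 \in I, p.2 \in I & (p.1 <= p.2)%R].

Definition locally_rectifiable (gamma : path) : Prop :=
  forall p, closed_subinterval (path_dom gamma) p ->
    curve_length p.1 p.2 (path_map gamma) < +oo.

Definition path_integral rho (gamma : path) : \bar R :=
  ereal_sup [set arclength_integral rho p.1 p.2 (path_map gamma)
            | p in closed_subinterval (path_dom gamma)].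

Definition admissible (Gamma : set path) rho : Prop :=
  [/\ forall x, 0 <= rho x,
      borel_fun rho
    & forall gamma, Gamma gamma -> locally_rectifiable gamma ->
        1 <= path_integral rho gamma].

Definition modulus (Gamma : set path) : \bar R :=
  ereal_inf [set \int[@leb R n]_x rho x ^+ n | rho in admissible Gamma].

Definition inverse_poletsky (D : set 'rV[R]_n) (f : 'rV[R]_n -> 'rV[R]_n) Q :
    Prop :=
  forall Gamma : set path,
    Gamma `<=` [set gamma | path_in D gamma /\ locally_rectifiable gamma] ->
  forall rho, admissible (path_comp f @` Gamma) rho ->
    modulus Gamma <= \int[@leb R n]_(y in f @` D) (Q y * rho y ^+ n).

End Modulus.

(* A mapping f of D into R^n is a total function, of which only the values on D
   matter. *)
Section Mappings.
Context {R : realType} {n : nat}.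
Implicit Types (D E : set 'rV[R]_n) (f F : 'rV[R]_n -> 'rV[R]_n).

Definition discrete_on D f : Prop :=
  forall y, D `&` f @^-1` [set y] `<=` isolated (D `&` f @^-1` [set y]).

Definition open_on D f : Prop :=
  forall U, U `<=` D -> open U -> open (f @` U).

Definition closed_in D E : Prop := exists2 K, closed K & E = D `&` K.

Definition closed_between D D' f : Prop :=
  forall E, E `<=` D -> closed_in D E -> closed_in D' (f @` E).

Definition class_S (delta : R) (A : set 'rV[R]_n) (Q : 'rV[R]_n -> \bar R) :
    set ('rV[R]_n -> 'rV[R]_n) :=
  [set f |
    [/\ {within unit_ball, continuous f}, f @` unit_ball = unit_ball,
        open_on unit_ball f, discrete_on unit_ball f
      & closed_between unit_ball unit_ball f] /\
    inverse_poletsky unit_ball f Q /\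
    (delta%:E <= edist (unit_ball `&` f @^-1` A) (frontier unit_ball))%E].

Definition is_extension f F : Prop :=
  [/\ {within closure unit_ball, continuous F},
      F @` closure unit_ball `<=` closure unit_ball
    & {in unit_ball, F =1 f}].

Definition L1_norm (D : set 'rV[R]_n) (Q : 'rV[R]_n -> \bar R) : R :=
  fine (\int[@leb R n]_(x in D) `|Q x|)%E.

End Mappings.

(* Main.v *)
Require Import Defs.
From HB Require Import structures.
From mathcomp Require Import all_boot all_order all_algebra.
From mathcomp Require Import all_classical all_reals all_analysis.
From mathcomp Require Import measurable_realfun ring lra.

(* If [f] maps two points near [x0] to points at distance [eps], join their images to
   [A] by two continua [K1], [K2] of the ball at mutual distance comparable to
   [min (eps, h0)], where [h0] depends on [A] only. As [f] is open and closed and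
   [f^-1 A] stays away from [x0], both [f^-1 K1] and [f^-1 K2] meet every sphere about
   [x0] of radius between [a] and [b], where [a] exceeds the distance of the two points
   from [x0] and [b = min (delta, 1)]. The segments of the ball whose ends have images
   at distance comparable to [min (eps, h0)] therefore have modulus at least
   [c * ln (b / a)]: for admissible [rho], connect a point of each preimage on the
   sphere of radius [r] to the points of a cube of size [r] inside the ball, average
   over the cube, and integrate against [dr / r]. The inverse Poletsky inequality with
   a constant [rho] bounds this modulus by [|Q|_1 / min (eps, h0) ^ n] up to a constant
   factor; when [a] is small the minimum has to be [eps]. *)

Set Implicit Arguments.
Unset Strict Implicit.
Unset Printing Implicit Defensive.

Import Order.TTheory GRing.Theory Num.Def Num.Theory.
Import numFieldNormedType.Exports.

Local Open Scope classical_set_scope.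
Local Open Scope ring_scope.

(** Nothing is known about how the points [p r] and [q r], chosen in the two preimages on the sphere
    of radius [r], depend on [r], so no integral over [r] may involve them. This shapes the lower
    bound for the modulus. The image of any [z] in the ball is far from that of [p r] or from that
    of [q r], so one of the two segments to [z] belongs to the family. Averaging over [z] replaces
    the points at parameter [th] of these segments by a shell that depends on [r] and [th] only. The
    average costs the Jacobian factor [(th * r)^(-n)], too singular at [th = 0]. A form of Young's
    inequality, with parameter proportional to [th^(1/n - 1) / r], reduces it to [th^(1/n - 2) / r];
    and a given point lies in the shells of a set of radii of [dr / r]-measure at most [96 * th],
    which leaves the integrable weight [th^(1/n - 1)]. The constant so obtained depends on [n]
    alone: [A] and [delta] enter only through the radii for which the estimate is made, and [Q]
    through these radii and its norm. *)

(** * The Euclidean inner product and norm *)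

Section EuclideanGeometry.
Context {R : realType} {n : nat}.
Implicit Types (x y z : 'rV[R]_n) (c : R).

Definition dot x y : R := \sum_(i < n) x ord0 i * y ord0 i.

Lemma dotC x y : dot x y = dot y x.
Proof. by apply: eq_bigr => i _; rewrite mulrC. Qed.

Lemma dotDl x y z : dot (x + y) z = dot x z + dot y z.
Proof. by rewrite -big_split; apply: eq_bigr => i _; rewrite mxE mulrDl. Qed.

Lemma dotZl c x y : dot (c *: x) y = c * dot x y.
Proof. by rewrite mulr_sumr; apply: eq_bigr => i _; rewrite mxE mulrA. Qed.

Lemma dotNl x y : dot (- x) y = - dot x y.
Proof. by rewrite -scaleN1r dotZl mulN1r. Qed.

Lemma dotBl x y z : dot (x - y) z = dot x z - dot y z.
Proof. by rewrite dotDl dotNl. Qed.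

Lemma dotDr x y z : dot x (y + z) = dot x y + dot x z.
Proof. by rewrite dotC dotDl !(dotC x). Qed.

Lemma dotZr c x y : dot x (c *: y) = c * dot x y.
Proof. by rewrite dotC dotZl (dotC x). Qed.

Lemma dotNr x y : dot x (- y) = - dot x y.
Proof. by rewrite dotC dotNl (dotC x). Qed.

Lemma dotBr x y z : dot x (y - z) = dot x y - dot x z.
Proof. by rewrite dotDr dotNr. Qed.

Definition dotE := (dotDl, dotDr, dotBl, dotBr, dotNl, dotNr, dotZl, dotZr).

Lemma dot_ge0 x : 0 <= dot x x.
Proof. by apply: sumr_ge0 => i _; rewrite -expr2 sqr_ge0. Qed.

Lemma enorm_ge0 x : 0 <= enorm x.
Proof. exact: sqrtr_ge0. Qed.

Lemma enorm_sqr x : enorm x ^+ 2 = dot x x.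
Proof. by rewrite sqr_sqrtr// sumr_ge0// => i _; rewrite sqr_ge0. Qed.

Lemma enormE x : enorm x = Num.sqrt (dot x x).
Proof. by []. Qed.

Lemma coord_le_enorm x i : `|x ord0 i| <= enorm x.
Proof.
rewrite -sqrtr_sqr ler_wsqrtr// (bigD1 i)//= lerDl sumr_ge0// => j _.
exact: sqr_ge0.
Qed.

Lemma enorm_eq0 x : enorm x = 0 -> x = 0.
Proof.
move=> x0; apply/rowP => i; apply/eqP; rewrite mxE -normr_le0 -x0.
exact: coord_le_enorm.
Qed.

Lemma enorm_gt0 x : x != 0 -> 0 < enorm x.
Proof.
by move=> x0; rewrite lt_neqAle enorm_ge0 andbT eq_sym; apply: contra_neq x0 => /enorm_eq0.
Qed.

Lemma enorm0 : enorm (0 : 'rV[R]_n) = 0.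
Proof. by rewrite enormE -(scale0r 0) dotZl mul0r sqrtr0. Qed.

Lemma enormZ c x : enorm (c *: x) = `|c| * enorm x.
Proof. by rewrite !enormE dotZl dotZr mulrA -expr2 sqrtrM ?sqr_ge0// sqrtr_sqr. Qed.

Lemma enormN x : enorm (- x) = enorm x.
Proof. by rewrite -scaleN1r enormZ normrN1 mul1r. Qed.

Lemma enormB x y : enorm (x - y) = enorm (y - x).
Proof. by rewrite -opprB enormN. Qed.

Lemma dot_le_enorm x y : dot x y <= enorm x * enorm y.
Proof.
have [->|/enorm_gt0 x0] := eqVneq x 0.
  by rewrite -(scale0r 0) dotZl enormZ normr0 !mul0r.
(* Expanded, this says [|x|^2 * (|x|^2 * |y|^2 - (x . y)^2) >= 0]. *)
have := dot_ge0 (dot x y *: x - enorm x ^+ 2 *: y).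
rewrite !dotE -!enorm_sqr (dotC y x) => h.
have [|xy0] := leP (dot x y) 0.
  by move=> /le_trans; apply; rewrite mulr_ge0 ?enorm_ge0.
rewrite -(ler_pXn2r (n := 2)) ?nnegrE ?mulr_ge0 ?enorm_ge0 ?(ltW xy0)//.
rewrite -(ler_pM2r (exprn_gt0 2 x0)) exprMn; lra.
Qed.

Lemma norm_dot_le_enorm x y : `|dot x y| <= enorm x * enorm y.
Proof.
rewrite ler_norml dot_le_enorm andbT -(enormN x) lerNl -dotNl.
exact: dot_le_enorm.
Qed.

Lemma enormD x y : enorm (x + y) <= enorm x + enorm y.
Proof.
rewrite -(ler_pXn2r (n := 2)) ?nnegrE ?addr_ge0 ?enorm_ge0//.
rewrite enorm_sqr sqrrD !enorm_sqr !dotE (dotC y x).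
by have := dot_le_enorm x y; lra.
Qed.

Lemma enorm_triangle z x y : enorm (x - y) <= enorm (x - z) + enorm (z - y).
Proof. by rewrite -[x - y](subrKA z) enormD. Qed.

Lemma enorm_le_add x y : enorm x <= enorm y + enorm (x - y).
Proof. by rewrite -{1}(subrKC y x) enormD. Qed.

Lemma enorm_dist x y : `|enorm x - enorm y| <= enorm (x - y).
Proof.
have := enorm_le_add x y; have := enorm_le_add y x; rewrite (enormB y x) => h1 h2.
by rewrite ler_norml; apply/andP; split; lra.
Qed.

Lemma enorm_le_sum x : enorm x <= \sum_(i < n) `|x ord0 i|.
Proof.
have s0 (r : seq 'I_n) : 0 <= \sum_(i <- r) `|x ord0 i| by apply: sumr_ge0.
rewrite -(ler_pXn2r (n := 2)) ?nnegrE ?enorm_ge0// enorm_sqr /dot.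
elim: (index_enum _) => [|i r ih]; first by rewrite !big_nil expr0n.
rewrite !big_cons sqrrD real_normK ?num_real// -expr2.
have := mulr_ge0 (normr_ge0 (x ord0 i)) (s0 r); lra.
Qed.

Lemma norm_le_enorm x : `|x| <= enorm x.
Proof.
rewrite /Num.norm/=; have [->|/mx_norm_neq0[[i j]]] := eqVneq (mx_norm x) 0.
  exact: enorm_ge0.
by rewrite (ord1 i) => -> /=; exact: coord_le_enorm.
Qed.

Lemma enorm_le_norm x : enorm x <= n%:R * `|x|.
Proof.
apply: le_trans (enorm_le_sum x) _.
rewrite -[n in n%:R]card_ord -sum1_card natr_sum mulr_suml ler_sum// => i _.
rewrite mul1r [leRHS]mx_normrE.
exact: (le_bigmax _ (fun ij : 'I_1 * 'I_n => `|x ij.1 ij.2|) (ord0, i)).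
Qed.

End EuclideanGeometry.

(** * Euclidean balls as neighbourhoods, the unit ball, segments *)

Section EuclideanTopology.
Context {R : realType} {n : nat}.
Implicit Types (x y z : 'rV[R]_n) (A : set 'rV[R]_n).

Lemma nbhs_eball x e : 0 < e -> nbhs x (eball x e).
Proof.
(* The added 1 keeps the divisor positive also in dimension 0. *)
move=> e0; have n0 : 0 < n%:R + 1 :> R by rewrite ltr_wpDl.
apply/nbhs_ballP; exists (e / (n%:R + 1)); first by rewrite /= divr_gt0.
move=> y; rewrite mx_norm_ball/= /ball_/= => xy.
apply: le_lt_trans (enorm_le_norm _) _.
rewrite distrC; apply: (@le_lt_trans _ _ ((n%:R + 1) * `|x - y|)).
  by rewrite ler_wpM2r// lerDl.
by rewrite mulrC -ltr_pdivlMr.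
Qed.

Lemma nbhs_eballP x A : nbhs x A <-> exists2 e, 0 < e & eball x e `<=` A.
Proof.
split=> [/nbhs_ballP[e e0 eA]|[e e0 eA]].
  exists e => // y xy; apply: eA; rewrite mx_norm_ball/= /ball_/= distrC.
  exact: le_lt_trans (norm_le_enorm _) xy.
exact: (@filterS _ _ (nbhs_filter x) _ _ eA (nbhs_eball x e0)).
Qed.

Lemma continuous_edist y : continuous (fun x => enorm (x - y)).
Proof.
move=> x; apply/(@cvgrPdist_lt _ _ _ (nbhs x)) => e e0.
apply/nbhs_eballP; exists e => // z xz; apply: le_lt_trans (enorm_dist _ _) _.
by rewrite opprB addrA subrK enormB.
Qed.

Lemma continuous_enorm : continuous (@enorm R n).
Proof.
rewrite (_ : enorm = fun x => enorm (x - 0)); first exact: continuous_edist.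
by apply/funext => x; rewrite subr0.
Qed.

Lemma open_eball x e : open (eball x e).
Proof.
rewrite (_ : eball x e = (fun y => enorm (y - x)) @^-1` [set r | r < e]); last by [].
by apply: open_comp => [y _|]; [exact: continuous_edist | exact: open_lt].
Qed.

Lemma closed_enorm_le r : closed [set x : 'rV[R]_n | enorm x <= r].
Proof.
rewrite (_ : mkset _ = @enorm R n @^-1` [set s | s <= r]); last by [].
by apply: closed_comp => [y _|]; [exact: continuous_enorm | exact: closed_le].
Qed.

Lemma closed_edist_le y r : closed [set x : 'rV[R]_n | enorm (x - y) <= r].
Proof.
rewrite (_ : mkset _ = (fun x => enorm (x - y)) @^-1` [set s | s <= r]); last by [].
by apply: closed_comp => [x _|]; [exact: continuous_edist | exact: closed_le].
Qed.

Lemma unit_ballE x : unit_ball x = (enorm x < 1) :> Prop.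
Proof. by rewrite /unit_ball/eball/= subr0. Qed.

Lemma open_unit_ball : open (@unit_ball R n).
Proof. exact: open_eball. Qed.

Lemma closure_unit_ball x : closure unit_ball x -> enorm x <= 1.
Proof.
have /closure_id cl1 := @closed_enorm_le 1.
suff /closure_subset : unit_ball `<=` [set x : 'rV[R]_n | enorm x <= 1].
  by rewrite -cl1 => h /h.
by move=> y; rewrite unit_ballE => /ltW.
Qed.

Lemma frontier_unit_ball x : frontier unit_ball x <-> closure unit_ball x /\ ~ unit_ball x.
Proof. by have /interior_id h := open_unit_ball; rewrite /frontier h. Qed.

Lemma frontier_enorm x : frontier unit_ball x -> enorm x = 1.
Proof.
rewrite frontier_unit_ball unit_ballE => -[/closure_unit_ball x1 /negP].
by rewrite -leNgt => x1'; apply/eqP; rewrite eq_le x1.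
Qed.

Lemma unit_ball_convex x y t : unit_ball x -> unit_ball y -> 0 <= t <= 1 ->
  unit_ball (x + t *: (y - x)).
Proof.
rewrite !unit_ballE => x1 y1 /andP[t0 t1].
rewrite (_ : _ + _ = (1 - t) *: x + t *: y); last first.
  by rewrite scalerBr scalerBl scale1r addrCA addrC.
apply: le_lt_trans (enormD _ _) _; rewrite !enormZ (ger0_norm t0) ger0_norm ?subr_ge0//.
have [->|t0'] := eqVneq t 0; first by rewrite subr0 mul1r mul0r addr0.
have : t * enorm y < t * 1 by rewrite ltr_pM2l// lt_neqAle eq_sym t0'.
have : (1 - t) * enorm x <= (1 - t) * 1 by rewrite ler_wpM2l ?subr_ge0// ltW.
lra.
Qed.

Definition segment x y : set 'rV[R]_n := [set x + t *: (y - x) | t in `[0, 1]%classic].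

Lemma segment_left x y : segment x y x.
Proof. by exists 0; rewrite ?scale0r ?addr0//= in_itv/= lexx ler01. Qed.

Lemma segment_right x y : segment x y y.
Proof. by exists 1; rewrite ?scale1r ?subrKC//= in_itv/= lexx ler01. Qed.

Lemma continuous_affine x y : continuous (fun t : R => x + t *: y).
Proof.
move=> t; apply: cvgD; first exact: cvg_cst.
by apply: cvgZr_tmp; exact: cvg_id.
Qed.

Lemma segment_compact x y : compact (segment x y).
Proof.
apply: continuous_compact; last exact: segment_compact.
by apply: continuous_subspaceT; exact: continuous_affine.
Qed.

Lemma segment_connected x y : connected (segment x y).
Proof.
apply: connected_continuous_connected; last first.
  by apply: continuous_subspaceT; exact: continuous_affine.
by apply/connected_intervalP; exact: interval_is_interval.
Qed.

Lemma segment_unit_ball x y : unit_ball x -> unit_ball y -> segment x y `<=` unit_ball.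
Proof. by move=> x1 y1 _ [t /= t01 <-]; apply: unit_ball_convex => //; rewrite in_itv in t01. Qed.

End EuclideanTopology.

(** * Caratheodory measurability of open sets *)

Section LebesgueBorel.
Context {R : realType} {n : nat}.

(** The part of a box on one side of the hyperplane where coordinate [i] equals [c]. The clipped
    side may be inverted; then [box] is empty and the maximum with 0 in [box_volume] gives volume
    0. *)
Definition clip_below (i : 'I_n) (c : R) (p : option ('rV[R]_n * 'rV[R]_n)) :=
  omap (fun ab : 'rV[R]_n * 'rV[R]_n => (ab.1,
    \row_j (if j == i then Num.min (ab.2 ord0 j) c else ab.2 ord0 j))) p.

Definition clip_above (i : 'I_n) (c : R) (p : option ('rV[R]_n * 'rV[R]_n)) :=
  omap (fun ab : 'rV[R]_n * 'rV[R]_n => (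
    \row_j (if j == i then Num.max (ab.1 ord0 j) c else ab.1 ord0 j), ab.2)) p.

Lemma max_sub_clip (a b c : R) :
  Num.max 0 (Num.min b c - a) + Num.max 0 (b - Num.max a c) = Num.max 0 (b - a).
Proof.
have [ac|ca] := leP a c; have [bc|cb] := leP b c.
- by rewrite [X in _ + X](max_idPl _) ?addr0// subr_le0.
- by rewrite !(max_idPr _) ?subr_ge0 ?(le_trans ac)//; lra.
- by rewrite !(max_idPl _) ?addr0// subr_le0 ltW// (le_lt_trans bc).
- by rewrite [X in X + _](max_idPl _) ?add0r// subr_le0 ltW.
Qed.

Lemma box_volume_clip i c p :
  box_volume (clip_below i c p) + box_volume (clip_above i c p) = box_volume p.
Proof.
case: p => [[a b]|] /=; last by rewrite addr0.
rewrite (bigD1 i)//= [X in _ + X](bigD1 i)//= [RHS](bigD1 i)//= !mxE eqxx.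
under eq_bigr => j /negbTE ji do rewrite mxE ji.
under [X in _ + _ * X]eq_bigr => j /negbTE ji do rewrite mxE ji.
rewrite -mulrDl; congr (_ * _).
exact: max_sub_clip.
Qed.

Local Open Scope ereal_scope.

(** Cutting each box of a cover of [X] along the hyperplane yields covers of the two parts of [X],
    and the volumes of the two halves of a box add up exactly. *)
Lemma halfspace_caratheodory i (c : R) :
  (@lebesgue_outer R n).-caratheodory [set x | (x ord0 i <= c)%R].
Proof.
apply: le_caratheodory_measurable => X.
apply: le_ereal_inf_tmp => _ [F XF <-].
rewrite (eq_eseriesr (g := fun k => (box_volume (clip_below i c (F k)))%:E +
    (box_volume (clip_above i c (F k)))%:E)); last first.
  by move=> k _; rewrite -EFinD box_volume_clip.
rewrite nneseriesD//; try by move=> *; exact: box_volume_ge0.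
apply: leeD; apply: ereal_inf_lbound.
- exists (clip_below i c \o F) => // x [/XF[k _ Fx] /= xc]; exists k => //=.
  move: Fx; rewrite /clip_below; case: (F k) => [[a b]|//] /= ab j.
  by have /andP[-> ?] := ab j; rewrite mxE; case: eqP => [->|//]; rewrite le_min xc (andP (ab i)).2.
- exists (clip_above i c \o F) => // x [/XF[k _ Fx] /= /negP xc]; exists k => //=.
  move: Fx; rewrite /clip_above; case: (F k) => [[a b]|//] /= ab j.
  have /andP[? ->] := ab j; rewrite andbT mxE; case: eqP => [->|//].
  by rewrite ge_max (andP (ab i)).1 ltW// ltNge.
Qed.

Lemma measurable_coord_lebesgue i :
  measurable_fun setT (fun x : caratheodory_type (@lebesgue_outer R n) => x ord0 i).
Proof.
apply: (measurability _ (RGenOInfty.measurableE R)) => _ [_ [c ->] <-].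
have /measurableC : measurable
    ([set x | (x ord0 i <= c)%R] : set (caratheodory_type (@lebesgue_outer R n))).
  exact: halfspace_caratheodory.
rewrite setTI; congr measurable.
by apply/seteqP; split => x /=; rewrite in_itv/= andbT ltNge => /negP.
Qed.

(** Makes every open set a union of countably many rational boxes, so that measurability of the
    coordinates suffices for measurability of preimages of open sets. *)
Lemma rat_box_nbhs (U : set 'rV[R]_n) (x : 'rV[R]_n) : open U -> U x ->
  exists ab : 'rV[rat]_n * 'rV[rat]_n,
    (forall i, (ratr (ab.1 ord0 i) < x ord0 i < ratr (ab.2 ord0 i))%R) /\
    [set y : 'rV[R]_n | forall i, (ratr (ab.1 ord0 i) < y ord0 i < ratr (ab.2 ord0 i))%R]
      `<=` U.
Proof.
rewrite openE => oU /oU /nbhs_eballP[e e0 eU].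
have n0 : (0 < n%:R + 1 :> R)%R by rewrite ltr_wpDl.
pose d := (e / (n%:R + 1))%R; have d0 : (0 < d)%R by rewrite divr_gt0.
have /choice[a Pa] : forall i : 'I_n, exists q : rat, (x ord0 i - d < ratr q < x ord0 i)%R.
  by move=> i; have [|q qP] := @rat_in_itvoo R (x ord0 i - d) (x ord0 i);
    [rewrite ltrBlDr ltrDl | exists q; rewrite in_itv in qP].
have /choice[b Pb] : forall i : 'I_n, exists q : rat, (x ord0 i < ratr q < x ord0 i + d)%R.
  by move=> i; have [|q qP] := @rat_in_itvoo R (x ord0 i) (x ord0 i + d);
    [rewrite ltrDl | exists q; rewrite in_itv in qP].
exists (\row_i a i, \row_i b i); split => [i|y yab].
  by rewrite /= !mxE (andP (Pa i)).2 (andP (Pb i)).1.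
apply: eU; rewrite /eball/=; apply: le_lt_trans (enorm_le_sum _) _.
apply: (@le_lt_trans _ _ (\sum_(i < n) d)%R).
  apply: ler_sum => i _; rewrite !mxE.
  have := yab i; rewrite /= !mxE => /andP[h1 h2].
  have /andP[h3 _] := Pa i; have /andP[_ h4] := Pb i.
  by rewrite ler_norml; apply/andP; split; lra.
rewrite sumr_const card_ord -mulr_natl /d mulrCA -[ltRHS]mulr1 ltr_pM2l//.
by rewrite ltr_pdivrMr// mul1r ltrDl.
Qed.

Lemma measurable_preimage_open d (T : measurableType d) (phi : T -> 'rV[R]_n)
    (mphi : forall i, measurable_fun setT (fun t => phi t ord0 i)) (U : set 'rV[R]_n) :
  open U -> measurable (phi @^-1` U).
Proof.
move=> oU.
pose B (ab : 'rV[rat]_n * 'rV[rat]_n) : set 'rV[R]_n :=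
  [set y | forall i, (ratr (ab.1 ord0 i) < y ord0 i < ratr (ab.2 ord0 i))%R].
have -> : phi @^-1` U = \bigcup_(ab in [set ab | B ab `<=` U]) (phi @^-1` B ab).
  apply/seteqP; split => [t Ut|t [ab abU tab]]; last exact: abU.
  by have [ab [h1 h2]] := rat_box_nbhs oU Ut; exists ab.
rewrite bigcup_mkcond; apply: countable_bigcupT_measurable => // ab.
case: ifPn => // _; rewrite (_ : _ @^-1` _ = \bigcap_(i in setT)
    ((fun t => phi t ord0 i) @^-1` `]ratr (ab.1 ord0 i), ratr (ab.2 ord0 i)[)); last first.
  apply/seteqP; split => [t h i _|t h i]/=; first by rewrite in_itv/=; exact: h.
  by have := h i I; rewrite /= in_itv.
apply: fin_bigcap_measurable => // i _.
by rewrite -[X in measurable X]setTI; exact: mphi.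
Qed.

End LebesgueBorel.

(** * Change of variables as an inequality *)

Section ChangeOfVariables.
Context d1 d2 (X : measurableType d1) (Y : measurableType d2) (R : realType).
Variables (mu : {measure set X -> \bar R}) (nu : {measure set Y -> \bar R}).
Local Open Scope ereal_scope.

(** Integrate [f] against the pushforward of [mu], which is at most [k] times [nu]. A one-sided
    bound is all that is asked of [phi]; for affine maps it can be read off from box covers. *)
Lemma ge0_le_integral_comp (phi : X -> Y) (k : R) (f : Y -> \bar R) :
  (0 <= k)%R -> measurable_fun setT phi ->
  (forall A, measurable A -> mu (phi @^-1` A) <= k%:E * nu A) ->
  measurable_fun setT f -> (forall y, 0 <= f y) ->
  \int[mu]_x f (phi x) <= k%:E * \int[nu]_y f y.
Proof.
move=> k0 mphi muk mf f0.
have := @ge0_integral_pushforward _ _ _ _ _ _ mphi mu setT f measurableT mf (fun y _ => f0 y).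
rewrite preimage_setT /comp => <-.
rewrite -(@ge0_integral_mscale _ _ _ nu setT measurableT (NngNum k0) f)//.
exact: ge0_le_measure_integral.
Qed.

End ChangeOfVariables.

(** * Lebesgue measure on the Borel sets *)

Section BorelLebesgue.
Context {R : realType} {n : nat}.

Definition borelV := g_sigma_algebraType (@open 'rV[R]_n).

HB.instance Definition _ := Measurable.on borelV.

Lemma open_borel (U : set 'rV[R]_n) : open U -> measurable (U : set borelV).
Proof. exact: sub_sigma_algebra. Qed.

Lemma measurable_fun_borelV d (T : measurableType d) (phi : T -> 'rV[R]_n) :
  (forall i, measurable_fun setT (fun t => phi t ord0 i)) ->
  measurable_fun setT (phi : T -> borelV).
Proof.
move=> mphi; apply: (@measurability _ _ T borelV setT phi (@open 'rV[R]_n)) => //.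
by move=> _ [U oU <-]; rewrite setTI; exact: measurable_preimage_open.
Qed.

Lemma measurable_fun_borel_continuous (f : 'rV[R]_n -> R) :
  continuous f -> measurable_fun setT (f : borelV -> R).
Proof.
move=> cf; apply: (measurability _ (RGenOpens.measurableE R)) => _ [_ [a [b ->]] <-].
rewrite setTI; apply: open_borel; apply: open_comp => // ? _; exact: cf.
Qed.

Lemma measurable_coord_borel i : measurable_fun setT (fun x : borelV => x ord0 i).
Proof. by apply: measurable_fun_borel_continuous; exact: coord_continuous. Qed.

Lemma borel_lebesgue (A : set 'rV[R]_n) :
  measurable (A : set borelV) ->
  measurable (A : set (caratheodory_type (@lebesgue_outer R n))).
Proof.
apply: smallest_sub; first exact: sigma_algebra_measurable.
move=> U oU.
exact: (@measurable_preimage_open R n _ (caratheodory_type (@lebesgue_outer R n)) id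
  (@measurable_coord_lebesgue R n) U oU).
Qed.

(** The same set function on the smaller sigma-algebra. There [rho] is measurable together with its
    compositions with continuous maps, and Tonelli's theorem can be applied to it. *)
Definition borel_leb : set borelV -> \bar R := @lebesgue_outer R n.

Let borel_leb0 : borel_leb set0 = 0%E. Proof. exact: lebesgue_outer0. Qed.

Let borel_leb_ge0 A : (0 <= borel_leb A)%E. Proof. exact: lebesgue_outer_ge0. Qed.

Let borel_leb_sigma_additive : semi_sigma_additive borel_leb.
Proof.
move=> F mF tF mUF; apply: caratheodory_measure_sigma_additive => //.
  by move=> i; exact: borel_lebesgue.
exact: borel_lebesgue.
Qed.

HB.instance Definition _ := isMeasure.Build _ borelV R borel_leb
  borel_leb0 borel_leb_ge0 borel_leb_sigma_additive.

Local Open Scope ereal_scope.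

Lemma integral_borel_leb (f : 'rV[R]_n -> \bar R) : borel_fun f -> (forall x, 0 <= f x) ->
  \int[@leb R n]_x f x = \int[borel_leb]_x f x.
Proof.
move=> mf f0.
pose phi : caratheodory_type (@lebesgue_outer R n) -> borelV := idfun.
have mphi : measurable_fun setT phi.
  by move=> _ A mA; rewrite setTI; exact: borel_lebesgue.
have := @ge0_integral_pushforward _ _ _ _ _ _ mphi (@leb R n) setT f measurableT mf
  (fun y _ => f0 y).
rewrite preimage_setT => <-; exact: eq_measure_integral.
Qed.

(** The preimage of a box is a box with all sides divided by [k], so covers of [A] turn into covers
    of the preimage. *)
Lemma lebesgue_outer_affine (c : 'rV[R]_n) (k : R) (A : set 'rV[R]_n) : (0 < k)%R ->
  lebesgue_outer ((fun x => c + k *: x)%R @^-1` A) <= (k^-1 ^+ n)%:E * lebesgue_outer A.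
Proof.
move=> k0; have kn0 : (0 < k^-1 ^+ n)%R by rewrite exprn_gt0// invr_gt0.
rewrite muleC -lee_pdivrMr//.
apply: le_ereal_inf_tmp => _ [F AF <-]; rewrite lee_pdivrMr// muleC.
rewrite -nneseriesZl//; last by move=> *; exact: box_volume_ge0.
pose G := omap (fun ab : 'rV[R]_n * 'rV[R]_n => (k^-1 *: (ab.1 - c), k^-1 *: (ab.2 - c))%R).
apply: ereal_inf_lbound; exists (G \o F).
  move=> x /AF[j _ Fx]; exists j => //=; move: Fx; rewrite /G.
  case: (F j) => [[a b]|//] /= h i; have := h i.
  by rewrite !mxE ler_pdivrMl// ler_pdivlMl// lerBlDl lerBrDl.
apply: eq_eseriesr => j _ /=; rewrite /G -EFinM; congr EFin.
case: (F j) => [[a b]|] /=; last by rewrite mulr0.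
transitivity (\prod_(i < n) (k^-1 * Num.max 0 (b ord0 i - a ord0 i)))%R.
  apply: eq_bigr => i _; rewrite maxr_pMr ?invr_ge0 ?(ltW k0)// mulr0 !mxE.
  by congr Num.max; ring.
by rewrite big_split/= prodr_const card_ord.
Qed.

Lemma box_volume_lebesgue (a b : 'rV[R]_n) :
  lebesgue_outer (box (Some (a, b))) <= (box_volume (Some (a, b)))%:E.
Proof.
apply: ereal_inf_lbound; exists (fun k => if k == 0%N then Some (a, b) else None).
  by move=> x abx; exists 0%N => //=; rewrite eqxx.
rewrite (nneseries_split 0 1) => [|*]; last exact: box_volume_ge0.
rewrite add0n big_nat1 eseries0 ?adde0// => k k1 _.
by case: k k1.
Qed.

Lemma box_coverT (x : 'rV[R]_n) :
  exists k : nat, box (Some (const_mx (- k%:R)%R, const_mx k%:R%R)) x.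
Proof.
exists (Num.bound `|x|) => i; rewrite !mxE -ler_norml ltW//.
apply: (@le_lt_trans _ _ `|x|)%R; last exact: archi_boundP.
rewrite [leRHS]mx_normrE.
exact: (le_bigmax _ (fun ij : 'I_1 * 'I_n => `|x ij.1 ij.2|%R) (ord0, i)).
Qed.

Lemma measurable_box (p : option ('rV[R]_n * 'rV[R]_n)) : measurable (box p : set borelV).
Proof.
case: p => [[a b]|]; last exact: measurable0.
rewrite (_ : box _ = \bigcap_(i in setT) ((fun x : borelV => x ord0 i) @^-1`
    `[a ord0 i, b ord0 i])).
  apply: fin_bigcap_measurable => // i _.
  by rewrite -[X in measurable X]setTI; exact: measurable_coord_borel.
apply/seteqP; split => [x h i _|x h i]/=; first by rewrite in_itv/=; exact: h.
by have := h i I; rewrite /= in_itv.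
Qed.

Let borel_leb_sigma_finite : sigma_finite setT borel_leb.
Proof.
exists (fun k => box (Some (const_mx (- k%:R)%R, const_mx k%:R%R))).
  by apply/esym/seteqP; split => // x _; have [k ?] := box_coverT x; exists k.
move=> k; split; first exact: measurable_box.
by rewrite (le_lt_trans (box_volume_lebesgue _ _))// ltry.
Qed.

HB.instance Definition _ := @Measure_isSigmaFinite.Build _ borelV R
  borel_leb borel_leb_sigma_finite.

End BorelLebesgue.
Arguments borelV : clear implicits.
Arguments borel_leb : clear implicits.

(** * A box cannot be covered by boxes of smaller total volume *)

Section BoxLowerBound.
Context {R : realType}.
Local Open Scope ereal_scope.

(* Induction on the dimension: integrate the inequality for the slices over the
   last coordinate. *)
Lemma prod_le_box_cover (m : nat) (c d : nat -> R) (S : set nat)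
    (a b : nat -> nat -> R) :
  (forall i, c i <= d i)%R ->
  (forall x : nat -> R, (forall i, (i < m)%N -> c i <= x i <= d i)%R ->
    exists2 k, S k & forall i, (i < m)%N -> (a k i <= x i <= b k i)%R) ->
  (\prod_(i < m) (d i - c i))%:E <=
  \sum_(0 <= k <oo) (\1_S k * \prod_(i < m) Num.max 0 (b k i - a k i))%:E.
Proof.
move=> cd; elim: m S => [|m ih] S cov.
  have [k Sk _] := cov c (fun i => ltac:(by [])).
  rewrite big_ord0; apply: le_trans (nneseries_lim_ge k.+1 _) => [|j _ _]; last first.
    by rewrite lee_fin big_ord0 mulr1.
  rewrite big_mkord (bigD1 (@ord_max k))//= big_ord0 mulr1 indicE mem_set// leeDl//.
  by apply: sume_ge0 => j _; rewrite lee_fin big_ord0 mulr1.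
(* The boxes of the cover that meet the slice at height [t]. Passing to slices discards boxes, which
   is why the statement carries a set [S] of indices. *)
pose T t := S `&` [set k | (a k m <= t <= b k m)%R].
pose v k := (\prod_(i < m) Num.max 0 (b k i - a k i))%R.
have v0 k : (0 <= v k)%R by apply: prodr_ge0 => i _; rewrite le_max lexx.
pose F k t : \bar R := (\1_(T t) k * v k)%:E.
have FE k t : F k t = ((\1_S k * v k) * \1_(`[a k m, b k m]%classic) t)%:E.
  rewrite /F !indicE.
  have -> : (k \in T t) = (k \in S) && (t \in `[a k m, b k m]%classic).
    by rewrite /T in_setI; congr (_ && _); apply/idP/idP; rewrite !inE/= in_itv.
  by case: (k \in S); case: (t \in _); rewrite /= ?(mul0r, mulr0, mul1r, mulr1).
have mF k : measurable_fun `[c m, d m] (F k).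
  apply: (@eq_measurable_fun _ _ _ _ _
    (fun t => ((\1_S k * v k) * \1_(`[a k m, b k m]%classic) t)%:E)).
    by move=> t _; rewrite FE.
  by apply/measurable_EFinP; apply: measurable_funM.
have F0 k t : 0 <= F k t by rewrite lee_fin mulr_ge0.
have slice t : (c m <= t <= d m)%R ->
    (\prod_(i < m) (d i - c i))%:E <= \sum_(0 <= k <oo) F k t.
  move=> tcd; apply: ih => x xcd.
  have [|k Sk kx] := cov (fun i => if (i < m)%N then x i else t).
    move=> i; rewrite ltnS leq_eqVlt => /orP[/eqP ->|im]; first by rewrite ltnn.
    by rewrite im; exact: xcd.
  exists k; first by split => //=; have := kx m (ltnSn m); rewrite ltnn.
  by move=> i im; have := kx i (ltnW im); rewrite im.
have intF k : \int[lebesgue_measure]_(t in `[c m, d m]) F k t <=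
    (\1_S k * \prod_(i < m.+1) Num.max 0 (b k i - a k i))%:E.
  rewrite big_ord_recr/= -/(v k) mulrA.
  under eq_integral do rewrite FE EFinM.
  have s0 : (0 <= \1_S k * v k)%R by rewrite mulr_ge0.
  rewrite ge0_integralZl//; last first.
    have mI : measurable_fun `[c m, d m]%classic (\1_(`[a k m, b k m]%classic) : R -> R).
      by apply: measurable_indic; exact: measurable_itv.
    have mEI : measurable_fun `[c m, d m]%classic
        (EFin \o (\1_(`[a k m, b k m]%classic) : R -> R)) by apply/measurable_EFinP; exact mI.
    exact mEI.
  rewrite integral_indic//.
  rewrite [leRHS]EFinM lee_wpmul2l ?lee_fin//.
  apply: (@le_trans _ _ (lebesgue_measure `[a k m, b k m])).
    by apply: le_measure; rewrite ?inE; [apply: measurableI| |exact: subIsetl].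
  rewrite lebesgue_measure_itv/= lte_fin; case: ifPn => ab.
    by rewrite -EFinB lee_fin le_max lexx orbT.
  by rewrite lee_fin le_max lexx.
apply: (@le_trans _ _
  (\sum_(0 <= k <oo) \int[lebesgue_measure]_(t in `[c m, d m]) F k t)); last first.
  by apply: lee_nneseries => [k _ _|k _]; [apply: integral_ge0 => t _ | exact: intF].
rewrite -integral_nneseries//.
rewrite big_ord_recr/= EFinM.
have <- : lebesgue_measure `[c m, d m]%classic = (d m - c m)%:E.
  rewrite lebesgue_measure_itv/= lte_fin; case: ltP => // dc.
  by congr EFin; apply/eqP; rewrite eq_sym subr_eq0 eq_le dc cd.
rewrite -integral_cst//; apply: ge0_le_integral => //.
- by move=> t _; rewrite lee_fin prodr_ge0// => i _; rewrite subr_ge0.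
- by apply: (@ge0_emeasurable_sum _ _ _ _ F xpredT).
Qed.

End BoxLowerBound.

Section BoxVolume.
Context {R : realType} {n : nat}.
Local Open Scope ereal_scope.

Lemma lebesgue_box (a b : 'rV[R]_n) : (forall i, a ord0 i <= b ord0 i)%R ->
  (\prod_(i < n) (b ord0 i - a ord0 i))%:E <= lebesgue_outer (box (Some (a, b))).
Proof.
move=> ab; apply: le_ereal_inf_tmp => _ [F cov <-].
(* Coordinates are continued by 0 to all natural indices, to fit the induction on the dimension; the
   empty boxes of the cover are left out by the index set. *)
pose co (u : 'rV[R]_n) (i : nat) : R := if insub i is Some j then u ord0 j else 0%R.
have coE u (i : 'I_n) : co u i = u ord0 i by rewrite /co valK.
pose A k := if F k is Some p then co p.1 else cst 0%R.
pose B k := if F k is Some p then co p.2 else cst 0%R.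
have := @prod_le_box_cover R n (co a) (co b) [set k | isSome (F k)] A B.
under eq_bigr => i _ do rewrite !coE.
move=> /(_ _ _)/le_trans; apply.
- by move=> i; rewrite /co; case: insub => // j.
- move=> x xab; have [|k _ Fx] := cov (\row_i x i).
    by move=> i; rewrite mxE -!coE; exact: xab.
  move: Fx; rewrite /A /B; case E : (F k) => [[u v]|//] /= Fx.
  exists k; first by rewrite /= E.
  move=> i im; rewrite E/=; have := Fx (Ordinal im).
  by rewrite mxE -[i]/(nat_of_ord (Ordinal im)) !coE.
- apply: lee_nneseries => [k _ _|k _].
    by rewrite lee_fin mulr_ge0// prodr_ge0// => i _; rewrite le_max lexx.
  rewrite lee_fin /A /B indicE; case E : (F k) => [[u v]|] /=.
    rewrite mem_set/= ?E// mul1r; under eq_bigr do rewrite !coE; exact: lexx.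
  by rewrite memNset ?mul0r//= E.
Qed.

End BoxVolume.

(** * Length and line integrals along straight segments *)

Section AffinePaths.
Context {R : realType}.
Local Open Scope ereal_scope.

Lemma lebesgue_measure_affine (c k : R) (A : set R) : (0 < k)%R -> measurable A ->
  lebesgue_measure ((fun u => c + k * u)%R @^-1` A) = k^-1%:E * lebesgue_measure A.
Proof.
move=> k0 mA; pose phi : R -> measurableTypeR R := fun u => (c + k * u)%R.
have mphi : measurable_fun setT phi.
  by apply: measurable_funD => //; apply: measurable_funM.
have k0' : (0 <= k)%R by exact: ltW.
pose nu : {measure set (measurableTypeR R) -> \bar R} :=
  mscale (NngNum k0') (pushforward lebesgue_measure phi).
suff -> : lebesgue_measure A = nu mphi A.
  by rewrite /nu/= /mscale/= muleA -EFinM mulVf ?gt_eqF// mul1e.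
apply: lebesgue_measure_unique => // _ [[a b] _ <-].
rewrite /nu/= /mscale/= /pushforward.
rewrite [X in _ = _ * lebesgue_measure X]
  (_ : _ = `](a - c) / k, (b - c) / k]%classic)%R; last first.
  apply/seteqP; split => u /=; rewrite !in_itv/= ltr_pdivrMr// ler_pdivlMr//;
    by rewrite ltrBlDl lerBrDl mulrC.
rewrite !lebesgue_measure_itv/= !lte_fin ltr_pM2r ?invr_gt0// ltrD2r.
case: ifPn => ab; last by rewrite mule0.
by rewrite -!EFinB -EFinM -mulrBl mulrC divfK ?gt_eqF//; congr EFin; ring.
Qed.

Context {n : nat}.
Implicit Types (p v : 'rV[R]_n) (rho : 'rV[R]_n -> \bar R).

Lemma polygonal_length_cons (a b x : R) (g : R -> 'rV[R]_n) s :
  polygonal_length a b g (x :: s) = (enorm (g x - g a) + polygonal_length x b g s)%R.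
Proof. by rewrite /polygonal_length/= big_nat_recl. Qed.

Lemma polygonal_length_affine p v (a b : R) s : path <%R a s ->
  polygonal_length a b (fun t => p + t *: v)%R s = ((last a s - a) * enorm v)%R.
Proof.
elim: s a => [|x s ih] a /=; first by rewrite /polygonal_length/= big_geq// subrr mul0r.
move=> /andP[ax xs]; rewrite polygonal_length_cons ih//.
rewrite opprD addrACA subrr add0r -scalerBl enormZ gtr0_norm ?subr_gt0//.
by ring.
Qed.

Lemma curve_length_affine p v (a b : R) : (a <= b)%R ->
  curve_length a b (fun t => p + t *: v)%R = ((b - a) * enorm v)%:E.
Proof.
move=> ab; rewrite /curve_length.
rewrite (_ : image _ _ = [set ((b - a) * enorm v)%:E]) ?ereal_sup1//.
apply/seteqP; split => [_ [s [/= sp /eqP sb] <-]|_ ->].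
  by rewrite polygonal_length_affine// sb.
move: ab; rewrite le_eqVlt => /orP[/eqP <-|ab].
  exists [::]; first by split => //=.
  by rewrite polygonal_length_affine.
exists [:: b]; first by split => //=; rewrite ?ab.
by rewrite polygonal_length_affine//= ab.
Qed.

(** For [v != 0] the length function is strictly increasing, so [get] picks from a set with exactly
    one element. *)
Lemma arclength_param_affine p v (a b u : R) : (v != 0)%R -> (a <= b)%R ->
  (0 <= u <= (b - a) * enorm v)%R ->
  arclength_param a b (fun t => p + t *: v)%R u = (p + (a + (enorm v)^-1 * u) *: v)%R.
Proof.
move=> /enorm_gt0 v0 ab /andP[u0 ub].
rewrite /arclength_param; set P := (X in get X).
have : P (a + (enorm v)^-1 * u)%R.
  have ? : (a <= a + (enorm v)^-1 * u)%R by rewrite lerDl mulr_ge0// invr_ge0 ltW.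
  split; last first.
    rewrite curve_length_affine//; congr EFin.
    by rewrite addrAC subrr add0r mulrAC mulVf ?gt_eqF// mul1r.
  by rewrite in_itv/=; apply/andP; split => //; rewrite -lerBrDl mulrC ler_pdivrMr.
move=> /getI[]; rewrite in_itv/= => /andP[h1 h2].
rewrite curve_length_affine// => -[h].
congr (p + _ *: v)%R; rewrite -h mulrCA mulVf ?gt_eqF// mulr1.
by rewrite addrC subrK.
Qed.

Lemma measurable_affine_path p v :
  measurable_fun setT ((fun t : R => p + t *: v)%R : R -> borelV R n).
Proof.
apply: measurable_fun_borelV => i.
under eq_fun do rewrite !mxE.
by apply: measurable_funD => //; apply: measurable_funM.
Qed.

(** Admissibility bounds [path_integral] from below, so this inequality is the one to use. Setting
    the integrand to 0 outside [[0, 1]] allows the substitution [t = a + u / |v|] to be made on the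
    whole line, for every closed subinterval [[a, b]] at once. *)
Lemma path_integral_affine rho p v : borel_fun rho -> (forall x, 0 <= rho x) ->
  (v != 0)%R ->
  path_integral rho (Path `[0%R, 1%R] (fun t => p + t *: v)%R) <=
  (enorm v)%:E * \int[lebesgue_measure]_(t in `[0%R, 1%R]) rho (p + t *: v)%R.
Proof.
move=> mrho rho0 v0; have ev0 := enorm_gt0 v0.
apply: ge_ereal_sup => _ [[a b] [/= a01 b01 ab] <-].
rewrite !in_itv/= in a01 b01; move: a01 b01 => /andP[a0 a1] /andP[b0 b1].
rewrite /arclength_integral curve_length_affine//=.
pose f := (fun t => rho (p + t *: v)%R) \_ `[0%R, 1%R].
have mg : measurable_fun setT (fun t : R => rho (p + t *: v)%R).
  exact: (measurableT_comp mrho (measurable_affine_path p v)).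
have mf : measurable_fun setT f.
  by apply/(measurable_restrictT _ _).1 => //; exact: measurable_funTS.
have f0 t : 0 <= f t by rewrite /f patchE; case: ifP.
rewrite [X in _ <= _ * X]integral_mkcond -/f.
pose phi (u : R) : R := (a + (enorm v)^-1 * u)%R.
have mphi : measurable_fun setT phi.
  by apply: measurable_funD => //; apply: measurable_funM.
apply: (@le_trans _ _ (\int[lebesgue_measure]_u f (phi u))); last first.
  apply: (@ge0_le_integral_comp _ _ _ _ R lebesgue_measure lebesgue_measure phi) => //.
    exact: ltW.
  move=> A mA; have := @lebesgue_measure_affine a (enorm v)^-1%R A.
  rewrite invr_gt0 invrK => /(_ ev0 mA) h.
  by rewrite le_eqVlt; apply/orP; left; apply/eqP.
rewrite (eq_integral (fun u : measurableTypeR R => f (phi u))); last first.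
  move=> u; rewrite inE/= in_itv/= => /andP[u0 ub].
  rewrite arclength_param_affine ?u0// /f patchE mem_set//= in_itv/=.
  have h : ((enorm v)^-1 * u <= b - a)%R by rewrite mulrC ler_pdivrMr.
  have h' : (0 <= (enorm v)^-1 * u)%R by rewrite mulr_ge0// invr_ge0 ltW.
  by rewrite /phi; apply/andP; split; lra.
apply: ge0_subset_integral => //.
exact: measurableT_comp.
Qed.

End AffinePaths.

(** * Integrals over intervals and a form of Young's inequality *)

Section ScalarIntegrals.
Context {R : realType}.

Lemma FTC2_is_derive (F f : R -> R) (a b : R) : a < b ->
  (forall x, a <= x <= b -> is_derive x 1 F (f x)) ->
  {within `[a, b], continuous f} ->
  (\int[lebesgue_measure]_(x in `[a, b]) (f x)%:E = (F b)%:E - (F a)%:E)%E.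
Proof.
move=> ab dF cf.
have cF x : a <= x <= b -> F y @[y --> x] --> F x.
  by move=> /dF[/derivable1_diffP/differentiable_continuous].
apply: continuous_FTC2 => //.
  split.
  - by move=> x; rewrite in_itv/= => /andP[/ltW ax /ltW xb]; have [] := dF x; rewrite ?ax.
  - by apply: cvg_at_right_filter; apply: cF; rewrite lexx ltW.
  - by apply: cvg_at_left_filter; apply: cF; rewrite lexx ltW.
move=> x; rewrite in_itv/= => /andP[/ltW ax /ltW xb].
by rewrite derive1E; apply: derive_val; apply: dF; rewrite ax.
Qed.

Lemma integral_inv (a b : R) : 0 < a -> a < b ->
  (\int[lebesgue_measure]_(x in `[a, b]) (x^-1)%:E = (ln (b / a))%:E)%E.
Proof.
move=> a0 ab.
rewrite ln_div ?posrE ?(lt_trans a0 ab)//.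
apply: FTC2_is_derive => //.
- by move=> x /andP[ax _]; apply: is_derive1_ln; exact: lt_le_trans ax.
- apply: continuous_in_subspaceT => x; rewrite inE/= in_itv/= => /andP[ax _].
  by apply: inv_continuous; rewrite gt_eqF// (lt_le_trans a0).
Qed.

Lemma continuous_powR (p x : R) : 0 < x -> {for x, continuous (fun y : R => y `^ p)}.
Proof.
move=> /(is_derive1_powR p)[/derivable1_diffP/differentiable_continuous] h _.
exact: h.
Qed.

Lemma integral_powR_le (p : R) : 0 < p ->
  (\int[lebesgue_measure]_(x in `]0%R, 1%R]) (x `^ (p - 1))%:E <= (p^-1)%:E)%E.
Proof.
move=> p0.
(* The power may be singular at 0, so the fundamental theorem of calculus is applied on an
   exhaustion; [k.+2] keeps the left end strictly below 1. *)
have Icov : `]0%R, 1%R]%classic = \bigcup_k `[((k.+2)%:R^-1 : R), 1%R]%classic.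
  apply/seteqP; split => [x|x [k _]]/=; rewrite !in_itv/= => /andP[x0 x1].
    exists (Num.bound x^-1) => //=; rewrite in_itv/= x1 andbT.
    rewrite invf_ple ?posrE//; apply: ltW; apply: lt_le_trans (archi_boundP _) _.
      by rewrite invr_ge0 ltW.
    by rewrite ler_nat ltnW.
  by rewrite x1 andbT; apply: lt_le_trans x0; rewrite invr_gt0.
rewrite Icov.
have := @ge0_nondecreasing_set_cvg_integral _ (measurableTypeR R) R
  (fun k => `[((k.+2)%:R^-1 : R), 1%R]%classic) (fun x => (x `^ (p - 1))%:E)
  lebesgue_measure.
move=> /(_ _ _ _ _)/cvg_lim hlim; rewrite -[leLHS]hlim//.
- apply: lime_le.
    apply: ereal_nondecreasing_is_cvgn => k l kl.
    apply: ge0_subset_integral => //.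
    + by apply/measurable_EFinP; exact: measurable_funTS (measurable_powR _).
    + by move=> x _; rewrite lee_fin powR_ge0.
    + move=> x /=; rewrite !in_itv/= => /andP[x0 ->]; rewrite andbT.
      by apply: le_trans x0; rewrite lef_pV2 ?posrE// ler_nat.
  apply: nearW => k.
  have k1 : (k.+2)%:R^-1 < 1 :> R by rewrite invf_lt1// ltr1n.
  apply: (@le_trans _ _ ((p^-1 * 1 `^ p)%:E - (p^-1 * (k.+2)%:R^-1 `^ p)%:E)%E); last first.
    by rewrite powR1 mulr1 -EFinB lee_fin gerBl mulr_ge0 ?powR_ge0// invr_ge0 ltW.
  rewrite le_eqVlt; apply/orP; left; apply/eqP.
  apply: (@FTC2_is_derive (fun x => p^-1 * x `^ p)) => //.
  + move=> x /andP[xk _]; have x0 : 0 < x by apply: lt_le_trans xk; rewrite invr_gt0.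
    have h := is_derive1_powR p x0.
    apply: is_derive_eq.
    by rewrite /GRing.scale/= mulrA mulVf ?mul1r// gt_eqF.
  + apply: continuous_in_subspaceT => x; rewrite inE/= in_itv/= => /andP[xk _].
    by apply: continuous_powR; apply: lt_le_trans xk; rewrite invr_gt0.
- move=> k l kl; apply/subsetPset => x /=; rewrite !in_itv/= => /andP[x0 ->]; rewrite andbT.
  by apply: le_trans x0; rewrite lef_pV2 ?posrE// ler_nat.
- by move=> k; apply/measurable_EFinP; exact: measurable_funTS (measurable_powR _).
- by move=> k x _; rewrite lee_fin powR_ge0.
Qed.

(** Either [x <= l], or [(x / l)^m >= 1]. It trades a first power of [rho] for an [n]-th power, [l]
    being free to depend on the point. *)
Lemma young_le (m : nat) (l : R) (x : \bar R) : 0 < l -> (0 <= x)%E ->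
  (x <= l%:E + (l^-1 ^+ m)%:E * x ^+ m.+1)%E.
Proof.
move=> l0; have lm0 : 0 < l^-1 ^+ m by rewrite exprn_gt0// invr_gt0.
case: x => [x||]//; last first.
  suff -> : (+oo ^+ m.+1 = +oo :> \bar R)%E by rewrite gt0_muley ?lte_fin// addey.
  by elim: m {lm0} => [//|m ih]; rewrite expeS ih mulyy.
rewrite lee_fin => x0; rewrite -EFin_expe -EFinM -EFinD lee_fin.
have [xl|lx] := leP x l.
  by rewrite (le_trans xl)// lerDl mulr_ge0 ?exprn_ge0// invr_ge0 ltW.
apply: ler_wpDl; first exact: ltW.
rewrite exprS mulrCA -exprMn ler_peMr// exprn_ege1// mulrC ler_pdivlMr// mul1r.
exact: ltW.
Qed.

(* Here [s] plays the role of [`|w - x0|]. *)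
Lemma integral_inv_shell (a b th s : R) : 0 < a -> 0 < th <= 1 -> 0 <= s ->
  (\int[lebesgue_measure]_(r in `[a, b])
     (if (`|s - r| <= 2 * th * r) && (r <= 8 * s) then r `^ (- 1) else 0)%:E
   <= (96 * th)%:E)%E.
Proof.
move=> a0 /andP[th0 th1] s0.
have s16 : 0 <= 16 * th * s by rewrite !mulr_ge0// ltW.
(* Where the integrand is not 0, [2 * th * r <= 16 * th * s] because [r <= 8 * s], and [s <= 3 * r]
   because [th <= 1]. So it is at most [3 / s] on an interval of length [32 * th * s], which gives
   [96 * th]. *)
pose J := `[s - 16 * th * s, s + 16 * th * s]%classic.
have mJ : measurable_fun `[a, b]%classic (\1_J : R -> R).
  by apply: measurable_indic; exact: measurable_itv.
apply: (@le_trans _ _ (\int[lebesgue_measure]_(r in `[a, b]) ((3 / s)%:E * (\1_J r)%:E))%E).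
  apply: ge0_le_integral => //.
  - by move=> r _; rewrite lee_fin; case: ifP => // _; exact: powR_ge0.
  - apply/measurable_EFinP; apply: measurable_funTS; apply: measurable_fun_ifT => //.
      apply: measurable_and; last exact: measurable_fun_ler.
      apply: measurable_fun_ler; last by apply: measurable_funM.
      by apply: measurableT_comp => //; exact: measurable_funB.
  - by apply/measurable_EFinP; apply: measurable_funM => //; exact mJ.
  - move=> r /=; rewrite in_itv/= => /andP[ar _]; have r0 := lt_le_trans a0 ar.
    rewrite -EFinM lee_fin.
    case: ifPn => [/andP[]|_]; last by rewrite mulr_ge0// divr_ge0.
    rewrite ler_norml => /andP[h1 h2] h3.
    have sp : 0 < s by lra.
    have t1 : 2 * th * r <= 16 * th * s.
      by rewrite -mulrA -[leRHS]mulrA mulrCA [leRHS]mulrCA ler_pM2l//; lra.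
    have t2 : 2 * th * r <= 2 * r by rewrite ler_wpM2r ?(ltW r0)//; lra.
    have -> : \1_J r = 1 :> R.
      by rewrite indicE mem_set// /J/= in_itv/=; apply/andP; split; lra.
    rewrite mulr1 powR_inv1 ?(ltW r0)//.
    by rewrite -[leLHS]mul1r ler_pdivrMr// mulrAC ler_pdivlMr// mul1r; lra.
have mEJ : measurable_fun `[a, b]%classic (EFin \o (\1_J : R -> R)).
  by apply/measurable_EFinP; exact mJ.
have s3 : 0 <= 3 / s by rewrite divr_ge0.
rewrite ge0_integralZl//.
rewrite integral_indic//; last exact: measurable_itv.
have [->|sn0] := eqVneq s 0; first by rewrite invr0 mulr0 mul0e lee_fin mulr_ge0// ltW.
have sp : 0 < s by rewrite lt_neqAle eq_sym sn0.
apply: (@le_trans _ _ ((3 / s)%:E * lebesgue_measure J)%E).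
  rewrite lee_wpmul2l ?lee_fin ?divr_ge0//.
  by apply: le_measure; rewrite ?inE /J; [apply: measurableI| |exact: subIsetl].
rewrite lebesgue_measure_itv/= lte_fin; case: ifPn => _; last first.
  by rewrite mule0 lee_fin mulr_ge0// ltW.
rewrite -EFinB -EFinM lee_fin le_eqVlt; apply/orP; left; apply/eqP; field.
exact: sn0.
Qed.

End ScalarIntegrals.

(** * Tonelli's theorem for sigma-finite measures, on products of sets *)

Section SigmaFiniteProduct.
Context d1 d2 (T1 : measurableType d1) (T2 : measurableType d2) (R : realType).
Variables (m1 : {sigma_finite_measure set T1 -> \bar R}).
Variables (m2 : {sigma_finite_measure set T2 -> \bar R}).
Local Open Scope ereal_scope.

(* On [m1 \x m2] itself, instance inference only finds the sigma-finite structure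
   of products of subprobabilities. *)
Definition sigma_finite_prod : set (T1 * T2) -> \bar R := m1 \x m2.

HB.instance Definition _ := Measure.copy sigma_finite_prod (m1 \x m2).

Let sigma_finite_prodT : sigma_finite setT sigma_finite_prod.
Proof.
have /sigma_finiteP[F [TF ndF Foo]] := sigma_finiteT m1.
have /sigma_finiteP[G [TG ndG Goo]] := sigma_finiteT m2.
exists (fun k => F k `*` G k).
  apply/esym/seteqP; split => // -[x y] _.
  have [i _ Fx] : (\bigcup_i F i) x by rewrite -TF.
  have [j _ Gy] : (\bigcup_i G i) y by rewrite -TG.
  exists (maxn i j) => //; split.
    by move: x Fx; exact/subsetPset/ndF/leq_maxl.
  by move: y Gy; exact/subsetPset/ndG/leq_maxr.
move=> k; have [mF oF] := Foo k; have [mG oG] := Goo k.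
split; first exact: measurableX.
by rewrite /sigma_finite_prod product_measure1E// lte_mul_pinfty// ge0_fin_numE.
Qed.

HB.instance Definition _ := @Measure_isSigmaFinite.Build _ _ R
  sigma_finite_prod sigma_finite_prodT.

End SigmaFiniteProduct.

Section TonelliRestricted.
Context d1 d2 (T1 : measurableType d1) (T2 : measurableType d2) (R : realType).
Variables (m1 : {sigma_finite_measure set T1 -> \bar R}).
Variables (m2 : {sigma_finite_measure set T2 -> \bar R}).
Variables (D1 : set T1) (D2 : set T2) (f : T1 * T2 -> \bar R).
Hypotheses (mD1 : measurable D1) (mD2 : measurable D2).
Hypotheses (mf : measurable_fun setT f) (f0 : forall x, (0 <= f x)%E).
Local Open Scope ereal_scope.

Let g : T1 * T2 -> \bar R := f \_ (D1 `*` D2).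

Let mg : measurable_fun setT g.
Proof.
apply/(measurable_restrictT _ _).1; first exact: measurableX.
exact: measurable_funTS.
Qed.

Let g0 x : 0 <= g x. Proof. by rewrite /g patchE; case: ifP. Qed.

Let gE x y : g (x, y) = if (x \in D1) && (y \in D2) then f (x, y) else 0.
Proof. by rewrite /g patchE in_setX. Qed.

Let int2 x : \int[m2]_y g (x, y) = ((fun x => \int[m2]_(y in D2) f (x, y)) \_ D1) x.
Proof.
rewrite patchE; case: ifPn => xD.
  rewrite [RHS]integral_mkcond; apply: eq_integral => y _.
  by rewrite gE xD patchE.
by apply: integral0_eq => y _; rewrite gE (negbTE xD).
Qed.

Let int1 y : \int[m1]_x g (x, y) = ((fun y => \int[m1]_(x in D1) f (x, y)) \_ D2) y.
Proof.
rewrite patchE; case: ifPn => yD.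
  rewrite [RHS]integral_mkcond; apply: eq_integral => x _.
  by rewrite gE yD andbT patchE.
by apply: integral0_eq => x _; rewrite gE (negbTE yD) andbF.
Qed.

Lemma tonelli_restrict :
  \int[m1]_(x in D1) \int[m2]_(y in D2) f (x, y) =
  \int[m2]_(y in D2) \int[m1]_(x in D1) f (x, y).
Proof.
rewrite integral_mkcond [RHS]integral_mkcond.
under eq_integral do rewrite -int2.
under [RHS]eq_integral do rewrite -int1.
exact: fubini_tonelli.
Qed.

Lemma tonelli_prod_restrict :
  \int[sigma_finite_prod m1 m2]_(z in D1 `*` D2) f z =
  \int[m1]_(x in D1) \int[m2]_(y in D2) f (x, y).
Proof.
rewrite integral_mkcond [RHS]integral_mkcond.
under [RHS]eq_integral do rewrite -int2.
exact: fubini_tonelli1.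
Qed.

Lemma measurable_fun_int2 : measurable_fun D1 (fun x => \int[m2]_(y in D2) f (x, y)).
Proof.
apply/(measurable_restrictT _ mD1).2.
rewrite (_ : _ \_ _ = fun x => \int[m2]_y g (x, y)); last by apply/funext => x; rewrite int2.
exact: measurable_fun_fubini_tonelli_F.
Qed.

Lemma measurable_fun_int1 : measurable_fun D2 (fun y => \int[m1]_(x in D1) f (x, y)).
Proof.
apply/(measurable_restrictT _ mD2).2.
rewrite (_ : _ \_ _ = fun y => \int[m1]_x g (x, y)); last by apply/funext => y; rewrite int1.
exact: measurable_fun_fubini_tonelli_G.
Qed.

End TonelliRestricted.

(** * Segments from a point of a sphere about a boundary point into the ball *)

Section ShellGeometry.
Context {R : realType} {n : nat}.
Implicit Types x y p : 'rV[R]_n.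

(** Equal to [(1 - r / 2) *: x + r *: y]: as [y] runs over a small cube about 0, a cube of size
    proportional to [r] about a point at depth [r / 2] below the boundary point [x]. *)
Definition inner_point x (r : R) y := x + r *: (y - 2^-1 *: x).

Lemma inner_point_unit_ball (x0 y : 'rV[R]_n) (r : R) :
  enorm x0 = 1 -> 0 < r <= 1 -> enorm y <= 1 / 8 -> enorm (inner_point x0 r y) < 1.
Proof.
move=> x01 /andP[r0 r1] y8.
have -> : inner_point x0 r y = (1 - r / 2) *: x0 + r *: y.
  by apply/rowP => i; rewrite !mxE; field.
apply: le_lt_trans (enormD _ _) _; rewrite !enormZ x01 (gtr0_norm r0) ger0_norm; last lra.
by have : r * enorm y <= r * (1 / 8) by [rewrite ler_wpM2l// ltW]; lra.
Qed.

Lemma inner_point_center (x0 y : 'rV[R]_n) (r : R) :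
  enorm x0 = 1 -> 0 < r -> enorm y <= 1 / 8 -> enorm (inner_point x0 r y - x0) <= r.
Proof.
move=> x01 r0 y8.
rewrite addrC addKr enormZ gtr0_norm// -[leRHS]mulr1 ler_wpM2l ?(ltW r0)//.
apply: le_trans (enormD _ _) _; rewrite enormN enormZ x01 ger0_norm//; lra.
Qed.

Lemma inner_point_dist (x0 p y : 'rV[R]_n) (r : R) :
  enorm x0 = 1 -> enorm (p - x0) = r -> 0 < r -> enorm y <= 1 / 8 ->
  enorm (inner_point x0 r y - p) <= 2 * r.
Proof.
move=> x01 pr r0 y8.
apply: le_trans (enorm_triangle x0 _ _) _.
by rewrite (enormB x0) pr; have := inner_point_center x01 r0 y8; lra.
Qed.

(** The first bound holds because the segment has length at most [2 * r]; it does not keep [w] away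
    from [x0] once [th >= 1 / 2], hence the second. That one holds since both ends of the segment,
    seen from [x0], lie essentially in the inward half-space: [dot x0 (p - x0) <= 0] as [p] is in
    the ball, so the two vectors cannot cancel. *)
Lemma segment_shell (x0 p y : 'rV[R]_n) (r th : R) :
  enorm x0 = 1 -> enorm p < 1 -> enorm (p - x0) = r -> 0 < r -> enorm y <= 1 / 8 ->
  0 <= th <= 1 -> forall w, w = p + th *: (inner_point x0 r y - p) ->
  (`|enorm (w - x0) - r| <= 2 * th * r) && (r <= 8 * enorm (w - x0)).
Proof.
move=> x01 p1 pr r0 y8 /andP[th0 th1] w wE0; apply/andP; split.
  rewrite -pr; apply: le_trans (enorm_dist _ _) _.
  rewrite (_ : _ - _ = th *: (inner_point x0 r y - p)); last first.
    by rewrite wE0; apply/rowP => i; rewrite !mxE; ring.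
  rewrite enormZ ger0_norm// -mulrA mulrCA ler_wpM2l// pr.
  exact: inner_point_dist.
have [P PE] : exists P, P = p - x0 by exists (p - x0).
have wE : w - x0 = (1 - th) *: P + th *: (r *: (y - 2^-1 *: x0)).
  by rewrite wE0 PE /inner_point; apply/rowP => i; rewrite !mxE; ring.
have PP : dot P P = r ^+ 2 by rewrite -enorm_sqr PE pr.
have xx : dot x0 x0 = 1 by rewrite -enorm_sqr x01 expr1n.
have xP : dot x0 P <= 0.
  have : dot p p < 1 by rewrite -enorm_sqr expr_lt1// enorm_ge0.
  have -> : p = x0 + P by rewrite PE subrKC.
  rewrite !dotE xx PP (dotC P); have := sqr_ge0 r; lra.
have yP : - (r / 8) <= dot y P.
  have := norm_dot_le_enorm y P; rewrite ler_norml {1}PE pr => /andP[h _].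
  by have := ler_wpM2r (ltW r0) y8; lra.
have yx : dot y x0 <= 1 / 8.
  by apply: le_trans (dot_le_enorm _ _) _; rewrite x01 mulr1.
have yy := dot_ge0 y.
have E : dot (w - x0) (w - x0) = (1 - th) ^+ 2 * r ^+ 2 +
    2 * th * (1 - th) * r * (dot y P - 2^-1 * dot x0 P) +
    th ^+ 2 * r ^+ 2 * (dot y y - dot y x0 + 1 / 4).
  by rewrite wE !dotE xx PP (dotC P y) (dotC P x0) (dotC x0 y); field.
rewrite -(ler_pXn2r (n := 2)) ?nnegrE ?mulr_ge0 ?enorm_ge0 ?(ltW r0)//.
rewrite exprMn enorm_sqr E.
set a := dot y P in yP *; set b := dot x0 P in xP *; set c := dot y x0 in yx *.
set e := dot y y in yy *.
have h1 : 2 * th * (1 - th) * r * (a - 2^-1 * b) >= 2 * th * (1 - th) * r * (- (r / 8)).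
  by rewrite ler_wpM2l ?mulr_ge0 ?subr_ge0 ?(ltW r0)//; lra.
have h2 : th ^+ 2 * r ^+ 2 * (e - c + 1 / 4) >= th ^+ 2 * r ^+ 2 * (1 / 8).
  by rewrite ler_wpM2l ?mulr_ge0 ?sqr_ge0//; lra.
(* After division by [r^2], what remains is [88 * th^2 - 144 * th + 63 >= 0]; its minimum is at
   [th = 9 / 11]. *)
have h3 : 0 <= r ^+ 2 * (11 * th - 9) ^+ 2 by rewrite mulr_ge0 ?sqr_ge0.
have h4 : 0 <= r ^+ 2 by rewrite sqr_ge0.
move: h1 h2 h3 h4; rewrite !expr2; nra.
Qed.

End ShellGeometry.

(** * Averaging over the cube at a fixed parameter of the segments *)

Section AveragedSegments.
Context {R : realType} {m : nat}.
Local Notation n := m.+1.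
Local Notation mu := (@lebesgue_measure R).
Local Notation nu := (borel_leb R n).
Local Open Scope ereal_scope.

Lemma measurable_fun_expe d (T : measurableType d) (D : set T) (f : T -> \bar R) k :
  measurable_fun D f -> measurable_fun D (fun x => f x ^+ k).
Proof.
move=> mf; elim: k => [|k ih]; first exact: measurable_cst.
by under eq_fun do rewrite expeS; exact: emeasurable_funM.
Qed.

(** By [segment_shell], it holds at the points of parameter [th] of all segments under
    consideration, wherever they start on the sphere of radius [r]. *)
Definition shell (x0 : 'rV[R]_n) (r th : R) (w : 'rV[R]_n) : bool :=
  ((`|enorm (w - x0) - r| <= 2 * th * r) && (r <= 8 * enorm (w - x0)))%R.

Lemma measurable_shell x0 d (T : measurableType d) (r th : T -> R) (w : T -> 'rV[R]_n) :
  measurable_fun setT r -> measurable_fun setT th ->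
  measurable_fun setT (w : T -> borelV R n) ->
  measurable_fun setT (fun t => shell x0 (r t) (th t) (w t)).
Proof.
move=> mr mth mw.
have me : measurable_fun setT (fun t => enorm (w t - x0)).
  apply: (measurableT_comp _ mw (f := fun x : borelV R n => enorm (x - x0)%R)).
  by apply: measurable_fun_borel_continuous; exact: continuous_edist.
apply: measurable_and; apply: measurable_fun_ler => //.
- by apply: measurableT_comp => //; exact: measurable_funB.
- by apply: measurable_funM => //; exact: measurable_funM.
- exact: measurable_funM.
Qed.

(** The half-side [1 / (8 * n)] puts it into the Euclidean ball of radius [1 / 8], as the geometry
    of [inner_point] requires. A cube is used because its volume is at hand. *)
Definition cube : set 'rV[R]_n :=
  box (Some (const_mx (- (8 * n%:R)^-1)%R, const_mx (8 * n%:R)^-1%R)).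

Lemma cube_enorm y : cube y -> (enorm y <= 1 / 8)%R.
Proof.
move=> Yy; apply: le_trans (enorm_le_sum _) _.
apply: (@le_trans _ _ (\sum_(i < n) (8 * n%:R)^-1)%R).
  by apply: ler_sum => i _; have := Yy i; rewrite !mxE -ler_norml.
rewrite sumr_const card_ord -[leLHS]mulr_natl le_eqVlt; apply/orP; left; apply/eqP.
by field; rewrite ?natr1 ?nat1r pnatr_eq0.
Qed.

Lemma measurable_cube : measurable (cube : set (borelV R n)).
Proof. exact: measurable_box. Qed.

Lemma cube_volume : exists2 V : R, (0 < V)%R & nu cube = V%:E.
Proof.
have n0 : (0 < 8 * n%:R :> R)%R by rewrite mulr_gt0.
have le (i : 'I_n) : ((const_mx (- (8 * n%:R)^-1) : 'rV[R]_n) ord0 i <=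
    (const_mx (8 * n%:R)^-1 : 'rV[R]_n) ord0 i)%R.
  by rewrite !mxE -subr_ge0 opprK addr_ge0// invr_ge0 ltW.
have hle := lebesgue_box le.
have hge := @box_volume_lebesgue R n (const_mx (- (8 * n%:R)^-1))%R (const_mx (8 * n%:R)^-1)%R.
have fin : nu cube \is a fin_num.
  rewrite ge0_fin_numE; first by rewrite (le_lt_trans hge)// ltry.
  exact: measure_ge0.
exists (fine (nu cube)); last by rewrite fineK.
rewrite -lte_fin fineK//; apply: lt_le_trans hle.
rewrite lte_fin; apply: prodr_gt0 => i _; rewrite !mxE opprK.
by rewrite addr_gt0// invr_gt0.
Qed.

Variable rho : 'rV[R]_n -> \bar R.
Hypotheses (mrho : borel_fun rho) (rho0 : forall x, 0 <= rho x).

Lemma measurable_shell_energy x0 d (T : measurableType d) (r th : T -> R) (w : T -> 'rV[R]_n) :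
  measurable_fun setT r -> measurable_fun setT th ->
  measurable_fun setT (w : T -> borelV R n) ->
  measurable_fun setT (fun t => if shell x0 (r t) (th t) (w t) then rho (w t) ^+ n else 0).
Proof.
move=> mr mth mw; apply: measurable_fun_ifT => //; first exact: measurable_shell.
by apply: measurable_fun_expe; exact: (measurableT_comp mrho mw).
Qed.

(** The starting point of the segments no longer occurs, so this is measurable in the parameters
    however that point is chosen for each [r]. *)
Definition energy x0 (r th : R) := \int[nu]_w (if shell x0 r th w then rho w ^+ n else 0).

Lemma energy_ge0 x0 r th : 0 <= energy x0 r th.
Proof. by apply: integral_ge0 => w _; case: ifP => // _; exact: expe_ge0. Qed.

Definition segment_to (p x0 : 'rV[R]_n) (r th : R) y : 'rV[R]_n :=
  (p + th *: (inner_point x0 r y - p))%R.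

Lemma measurable_segment_to (p x0 : 'rV[R]_n) (r : R) d (T : measurableType d)
    (th : T -> R) (y : T -> 'rV[R]_n) : measurable_fun setT th ->
  measurable_fun setT (y : T -> borelV R n) ->
  measurable_fun setT ((fun t => segment_to p x0 r (th t) (y t)) : T -> borelV R n).
Proof.
move=> mth my; apply: measurable_fun_borelV => i.
under eq_fun do rewrite !mxE.
have myi : measurable_fun setT (fun t => y t ord0 i).
  exact: (measurableT_comp (measurable_coord_borel i) my).
apply: measurable_funD => //; apply: measurable_funM => //; apply: measurable_funB => //.
apply: measurable_funD => //; apply: measurable_funM => //; exact: measurable_funB.
Qed.

(** Young's inequality pointwise, then a change of variables: [segment_to p x0 r th] is affine in
    [y] of ratio [th * r] and maps the cube into the shell. *)
Lemma segment_average_at (x0 p : 'rV[R]_n) (r th l : R) :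
  enorm x0 = 1%R -> (enorm p < 1)%R -> enorm (p - x0) = r -> (0 < r <= 1)%R ->
  (0 < th <= 1)%R -> (0 < l)%R ->
  \int[nu]_(y in cube) rho (segment_to p x0 r th y) <=
  l%:E * nu cube + (l^-1 ^+ m * (th * r)^-1 ^+ n)%:E * energy x0 r th.
Proof.
move=> x01 p1 pr /andP[r0 r1] /andP[th0 th1] l0.
pose h w := if shell x0 r th w then rho w ^+ n else 0.
have h0 w : 0 <= h w by rewrite /h; case: ifP => // _; exact: expe_ge0.
have mh : measurable_fun setT (h : borelV R n -> \bar R).
  apply: measurable_shell_energy => //; exact: measurable_id.
have mphi : measurable_fun setT (segment_to p x0 r th : borelV R n -> borelV R n).
  by apply: measurable_segment_to => //; exact: measurable_id.
have lm0 : (0 <= l^-1 ^+ m)%R by rewrite exprn_ge0// invr_ge0 ltW.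
apply: (@le_trans _ _ (\int[nu]_(y in cube)
    (l%:E + (l^-1 ^+ m)%:E * h (segment_to p x0 r th y)))).
  apply: ge0_le_integral => //; first exact: measurable_cube.
  - by apply: measurable_funTS; exact: (measurableT_comp mrho mphi).
  - apply: measurable_funTS; apply: emeasurable_funD => //.
    by apply: measurable_funeM; exact: (measurableT_comp mh mphi).
  - move=> y Yy; have /= := segment_shell x01 p1 pr r0 (cube_enorm Yy).
    move=> /(_ th); rewrite (ltW th0) th1 => /(_ isT _ erefl) sh.
    by rewrite /h /shell sh; exact: young_le.
rewrite ge0_integralD//; last 4 first.
- exact: measurable_cube.
- by move=> y _; rewrite lee_fin ltW.
- by move=> y _; rewrite mule_ge0// lee_fin.
- by apply: measurable_funTS; apply: measurable_funeM; exact: (measurableT_comp mh mphi).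
rewrite integral_cst; last exact: measurable_cube.
apply: leeD => //.
rewrite ge0_integralZl//; last 2 first.
- exact: measurable_cube.
- by apply: measurable_funTS; exact: (measurableT_comp mh mphi).
rewrite EFinM -muleA lee_wpmul2l ?lee_fin//.
apply: (@le_trans _ _ (\int[nu]_y h (segment_to p x0 r th y))).
  apply: ge0_subset_integral => //; first exact: measurable_cube.
  exact: (measurableT_comp mh mphi).
have thr0 : (0 < th * r)%R by rewrite mulr_gt0.
apply: (@ge0_le_integral_comp _ _ _ _ R nu nu (segment_to p x0 r th)) => //.
  by rewrite exprn_ge0// invr_ge0 ltW.
move=> A mA.
rewrite (_ : _ @^-1` _ = (fun y => (p + th *: (x0 - (r / 2) *: x0 - p)) + (th * r) *: y)%R @^-1` A).
  exact: lebesgue_outer_affine.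
apply/funext => y /=; congr A; rewrite /segment_to /inner_point.
by apply/rowP => i; rewrite !mxE; field.
Qed.

End AveragedSegments.

(** * Integration along the segments *)

Section ModulusLowerBound.
Context {R : realType} {m : nat}.
Local Notation n := m.+1.
Local Notation mu := (@lebesgue_measure R).
Local Notation nu := (borel_leb R n).
Local Notation alpha := (n%:R^-1 : R).
Local Open Scope ereal_scope.

(** The left side is the coefficient of the energy for the Young parameter
    [l = K / r * th^(alpha - 1)]. With this exponent the other term carries [th^(alpha - 1)], and so
    does the energy term once the thinness of the shells has supplied a factor [th]. *)
Lemma young_coefficient (K r th : R) : (0 < K)%R -> (0 < r)%R -> (0 < th)%R ->
  ((K / r * th `^ (alpha - 1))^-1 ^+ m * (th * r)^-1 ^+ n =
   K^-1 ^+ m / r * th `^ (alpha - 2))%R.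
Proof.
move=> K0 r0 th0; have n0 : (n%:R != 0 :> R)%R by rewrite pnatr_eq0.
have -> : (th `^ (alpha - 2) = (th `^ (alpha - 1))^-1 ^+ m * th^-1 ^+ n)%R.
  have -> : ((th `^ (alpha - 1))^-1 ^+ m = th `^ (- (alpha - 1) * m%:R))%R.
    by rewrite -powRN powRrM powR_mulrn ?powR_ge0.
  have -> : (th^-1 ^+ n = th `^ (- n%:R))%R by rewrite powRN powR_mulrn ?exprVn// ltW.
  rewrite -powRD; last by rewrite (gt_eqF th0) implybT.
  by congr powR; rewrite -natr1; field; rewrite ?natr1 ?nat1r pnatr_eq0.
rewrite !invfM !invrK !exprMn [(r^-1 ^+ n)%R]exprS.
have rm : (r ^+ m * r^-1 ^+ m = 1)%R by rewrite -exprMn divff ?expr1n// gt_eqF.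
set G := ((th `^ (alpha - 1))^-1 ^+ m)%R; set T := (th^-1 ^+ n)%R; set k := (K^-1 ^+ m)%R.
transitivity (k * G * T * r^-1 * (r ^+ m * r^-1 ^+ m))%R; first by ring.
by rewrite rm; ring.
Qed.

Variable rho : 'rV[R]_n -> \bar R.
Hypotheses (mrho : borel_fun rho) (rho0 : forall x, 0 <= rho x).

Lemma measurable_segment_pair (p x0 : 'rV[R]_n) (r : R) :
  measurable_fun setT (fun z : borelV R n * measurableTypeR R =>
    rho (segment_to p x0 r z.2 z.1)).
Proof.
apply: (measurableT_comp mrho).
by apply: (@measurable_segment_to _ _ p x0 r _ (borelV R n * measurableTypeR R)%type snd fst).
Qed.

Lemma measurable_energy x0 (r : R) :
  measurable_fun (`]0%R, 1%R]%classic : set R) (energy rho x0 r : R -> \bar R).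
Proof.
pose f (z : measurableTypeR R * borelV R n) : \bar R :=
  if shell x0 r z.1 z.2 then rho z.2 ^+ n else 0.
have mf : measurable_fun setT f.
  by apply: measurable_shell_energy => //.
have f0 z : 0 <= f z by rewrite /f; case: ifP => // _; exact: expe_ge0.
have := @measurable_fun_int2 _ _ (measurableTypeR R) (borelV R n) R nu
  `]0%R, 1%R]%classic setT f (measurable_itv _) measurableT mf f0.
exact.
Qed.

Lemma segment_average (x0 p : 'rV[R]_n) (r K : R) :
  enorm x0 = 1%R -> (enorm p < 1)%R -> enorm (p - x0) = r -> (0 < r <= 1)%R ->
  (0 < K)%R ->
  \int[nu]_(y in cube) \int[mu]_(th in `]0%R, 1%R]) rho (segment_to p x0 r th y) <=
  \int[mu]_(th in `]0%R, 1%R]) ((K / r * th `^ (alpha - 1))%:E * nu cube +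
    (K^-1 ^+ m / r * th `^ (alpha - 2))%:E * energy rho x0 r th).
Proof.
move=> x01 p1 pr /andP[r0 r1] K0.
rewrite (@tonelli_restrict _ _ (borelV R n) (measurableTypeR R) R nu mu cube `]0%R, 1%R]%classic
  (fun z => rho (segment_to p x0 r z.2 z.1)) measurable_cube (measurable_itv _)
  (measurable_segment_pair p x0 r) (fun z => rho0 _)).
apply: ge0_le_integral => //.
- by move=> th _; exact: integral_ge0.
- apply: (@measurable_fun_int1 _ _ (borelV R n) (measurableTypeR R) R nu cube `]0%R, 1%R]%classic
    (fun z => rho (segment_to p x0 r z.2 z.1))) => //; first exact: measurable_cube.
  exact: measurable_segment_pair.
- have [V _ ->] := @cube_volume R m.
  apply: emeasurable_funD.
    apply: emeasurable_funM => //; apply/measurable_EFinP.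
    by apply: measurable_funM => //; exact: measurable_funTS (measurable_powR _).
  apply: emeasurable_funM; last exact: measurable_energy.
  apply/measurable_EFinP.
  by apply: measurable_funM => //; exact: measurable_funTS (measurable_powR _).
- move=> th /=; rewrite in_itv/= => /andP[th0 th1].
  rewrite -young_coefficient//; apply: segment_average_at => //; rewrite ?r0 ?th0//.
  by rewrite mulr_gt0// ?divr_gt0// powR_gt0.
Qed.

End ModulusLowerBound.

Section ModulusLowerBoundLog.
Context {R : realType} {m : nat}.
Local Notation n := m.+1.
Local Notation mu := (@lebesgue_measure R).
Local Notation nu := (borel_leb R n).
Local Notation alpha := (n%:R^-1 : R).
Local Open Scope ereal_scope.

Variable rho : 'rV[R]_n -> \bar R.
Hypotheses (mrho : borel_fun rho) (rho0 : forall x, 0 <= rho x).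

Definition segment_integral (p z : 'rV[R]_n) : \bar R :=
  (enorm (z - p))%:E * \int[mu]_(t in `[0%R, 1%R]) rho (p + t *: (z - p))%R.

Lemma measurable_powR_E (b : R) D : measurable_fun D (fun t : measurableTypeR R => (t `^ b)%:E).
Proof. by apply/measurable_EFinP; exact: measurable_funTS (measurable_powR _). Qed.

Lemma segment_integral_inner (x0 p y : 'rV[R]_n) (r : R) :
  enorm x0 = 1%R -> enorm (p - x0) = r -> (0 < r)%R -> cube y ->
  segment_integral p (inner_point x0 r y) <=
  (2 * r)%:E * \int[mu]_(t in `]0%R, 1%R]) rho (segment_to p x0 r t y).
Proof.
move=> x01 pr r0 Yy; rewrite /segment_integral.
rewrite -integral_itv_obnd_cbnd; last first.
  apply: measurable_funTS.
  exact: (measurableT_comp mrho (measurable_affine_path p _)).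
rewrite lee_wpmul2r ?integral_ge0// lee_fin.
exact: inner_point_dist (cube_enorm Yy).
Qed.

Lemma measurable_segment_average (x0 p : 'rV[R]_n) (r : R) :
  measurable_fun (cube : set (borelV R n)) (fun y : borelV R n =>
    \int[mu]_(t in `]0%R, 1%R]) rho (segment_to p x0 r t y)).
Proof.
have := @measurable_fun_int2 _ _ (borelV R n) (measurableTypeR R) R mu cube
  `]0%R, 1%R]%classic (fun z => rho (segment_to p x0 r z.2 z.1)) measurable_cube
  (measurable_itv _) (measurable_segment_pair mrho p x0 r) (fun z => rho0 _).
exact.
Qed.

(** Averaging the last hypothesis over the points [z = inner_point x0 r y] bounds [V] by two
    averages of [rho] along segments. Young's inequality splits each into a constant, absorbed on
    the left, and an energy. *)
Lemma energy_lower_bound (V : R) (x0 p q : 'rV[R]_n) (r : R) :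
  nu cube = V%:E -> enorm x0 = 1%R -> (0 < r <= 1)%R ->
  (enorm p < 1)%R -> enorm (p - x0) = r ->
  (enorm q < 1)%R -> enorm (q - x0) = r ->
  (forall z, (enorm z < 1)%R -> 1 <= segment_integral p z + segment_integral q z) ->
  (V / 2)%:E <= (4 * (8 * n%:R) ^+ m)%:E *
    \int[mu]_(th in `]0%R, 1%R]) ((th `^ (alpha - 2))%:E * energy rho x0 r th).
Proof.
move=> YV x01 r01 p1 pr q1 qr H.
have /andP[r0 r1] := r01.
have V0 : (0 <= V)%R by rewrite -lee_fin -YV measure_ge0.
set S := (X in _ * X).
have S0 : 0 <= S.
  by apply: integral_ge0 => th _; rewrite mule_ge0 ?energy_ge0// lee_fin powR_ge0.
(* As the integral of [th^(alpha - 1)] is at most [n], the constant term is at most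
   [2 * r * (K / r) * V * n = V / 4] for each of [p] and [q], so that [V / 2] is left. *)
pose K : R := ((8 * n%:R)^-1)%R.
have n0 : (0 < n%:R :> R)%R by rewrite ltr0n.
have K0 : (0 < K)%R by rewrite invr_gt0 mulr_gt0.
have [I IE] : exists I : 'rV[R]_n -> 'rV[R]_n -> \bar R,
    I = fun u y => \int[mu]_(t in `]0%R, 1%R]) rho (segment_to u x0 r t y).
  by exists (fun u y => \int[mu]_(t in `]0%R, 1%R]) rho (segment_to u x0 r t y)).
have avg u : (enorm u < 1)%R -> enorm (u - x0) = r ->
    (2 * r)%:E * \int[nu]_(y in cube) I u y <=
    (V / 4)%:E + (2 * (8 * n%:R) ^+ m)%:E * S.
  move=> u1 ur; rewrite IE.
  pose F1 (th : R) : \bar R := (K / r * th `^ (alpha - 1))%:E * V%:E.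
  pose F2 (th : R) : \bar R := (K^-1 ^+ m / r * th `^ (alpha - 2))%:E * energy rho x0 r th.
  have F10 th : 0 <= F1 th.
    by rewrite /F1 -EFinM lee_fin !mulr_ge0 ?powR_ge0 ?invr_ge0// ltW.
  have F20 th : 0 <= F2 th.
    rewrite /F2 mule_ge0 ?energy_ge0// lee_fin mulr_ge0 ?powR_ge0//.
    by rewrite mulr_ge0 ?invr_ge0 ?exprn_ge0// ?invr_ge0 ltW.
  have mF1 : measurable_fun (`]0%R, 1%R]%classic : set (measurableTypeR R)) F1.
    apply: emeasurable_funM => //; apply/measurable_EFinP.
    by apply: measurable_funM => //; exact: measurable_funTS (measurable_powR _).
  have mF2 : measurable_fun (`]0%R, 1%R]%classic : set (measurableTypeR R)) F2.
    apply: emeasurable_funM; last exact: measurable_energy.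
    apply/measurable_EFinP.
    by apply: measurable_funM => //; exact: measurable_funTS (measurable_powR _).
  have := segment_average mrho rho0 x01 u1 ur r01 K0; rewrite YV.
  rewrite (@ge0_integralD _ (measurableTypeR R) R mu _ (measurable_itv _) F1 F2)//.
  move=> h; apply: (le_trans (lee_wpmul2l _ h)).
    by rewrite lee_fin mulr_ge0// ltW.
  rewrite ge0_muleDr; last 2 first.
  - exact: integral_ge0.
  - exact: integral_ge0.
  apply: leeD.
    rewrite (eq_integral (fun th : measurableTypeR R =>
      (K / r * V)%:E * (th `^ (alpha - 1))%:E)); last first.
      by move=> th _; rewrite -!EFinM; congr EFin; ring.
    have k0 : (0 <= K / r * V)%R by rewrite !mulr_ge0 ?invr_ge0// ltW.
    have p0 th : 0 <= (th `^ (alpha - 1))%:E by rewrite lee_fin powR_ge0.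
    rewrite (@ge0_integralZl _ (measurableTypeR R) R mu _ (measurable_itv _) _
      (@measurable_powR_E (alpha - 1) _) _ (fun th _ => p0 th))//.
    have c0 : (0 <= 2 * r * (K / r * V))%R by rewrite !mulr_ge0 ?invr_ge0// ltW.
    rewrite muleA -EFinM.
    apply: (@le_trans _ _ ((2 * r * (K / r * V))%:E * n%:R%:E)).
      rewrite lee_wpmul2l ?lee_fin//.
      have := @integral_powR_le R alpha; rewrite invr_gt0 invrK; exact.
    rewrite -EFinM lee_fin le_eqVlt; apply/orP; left; apply/eqP.
    by rewrite /K; field; rewrite ?natr1 ?nat1r pnatr_eq0 gt_eqF.
  rewrite (eq_integral (fun th : measurableTypeR R => (K^-1 ^+ m / r)%:E *
      ((th `^ (alpha - 2))%:E * energy rho x0 r th))); last first.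
    by move=> th _; rewrite EFinM muleA.
  have k0 : (0 <= K^-1 ^+ m / r)%R by rewrite mulr_ge0 ?invr_ge0 ?exprn_ge0// ?invr_ge0 ltW.
  have mE : measurable_fun (`]0%R, 1%R]%classic : set (measurableTypeR R))
      (fun th => (th `^ (alpha - 2))%:E * energy rho x0 r th).
    by apply: emeasurable_funM; [exact: measurable_powR_E | exact: measurable_energy].
  have E0 th : 0 <= (th `^ (alpha - 2))%:E * energy rho x0 r th.
    by rewrite mule_ge0 ?energy_ge0// lee_fin powR_ge0.
  rewrite (@ge0_integralZl _ (measurableTypeR R) R mu _ (measurable_itv _) _ mE _
    (fun th _ => E0 th))//.
  rewrite -/S muleA -EFinM lee_wpmul2r// lee_fin /K invrK.
  rewrite le_eqVlt; apply/orP; left; apply/eqP; field.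
  by rewrite gt_eqF.
have : V%:E <= (V / 2)%:E + (4 * (8 * n%:R) ^+ m)%:E * S.
  have -> : (V / 2)%:E + (4 * (8 * n%:R) ^+ m)%:E * S =
      ((V / 4)%:E + (2 * (8 * n%:R) ^+ m)%:E * S) + ((V / 4)%:E + (2 * (8 * n%:R) ^+ m)%:E * S).
    have a0 : 0 <= (2 * (8 * n%:R) ^+ m)%:E :> \bar R.
      by rewrite lee_fin !mulr_ge0// exprn_ge0// mulr_ge0// ltW.
    rewrite addeACA -EFinD -ge0_muleDl// -EFinD.
    by congr (_%:E + _%:E * _); field.
  apply: le_trans (leeD (avg p p1 pr) (avg q q1 qr)).
  have r2 : (0 <= 2 * r)%R by rewrite mulr_ge0// ltW.
  have mI u : measurable_fun (cube : set (borelV R n)) (I u).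
    by rewrite IE; exact: measurable_segment_average.
  have I0 u y : 0 <= I u y by rewrite IE; exact: integral_ge0.
  have mrI u : measurable_fun (cube : set (borelV R n)) (fun y => (2 * r)%:E * I u y).
    exact: measurable_funeM.
  have rI0 u y : 0 <= (2 * r)%:E * I u y by rewrite mule_ge0// lee_fin.
  rewrite -(@ge0_integralZl _ (borelV R n) R nu cube measurable_cube (I p) (mI p)
    (2 * r)%:E (fun y _ => I0 p y))//.
  rewrite -(@ge0_integralZl _ (borelV R n) R nu cube measurable_cube (I q) (mI q)
    (2 * r)%:E (fun y _ => I0 q y))//.
  rewrite -(@ge0_integralD _ (borelV R n) R nu cube measurable_cube _ _
    (fun y _ => rI0 p y) (mrI p) (fun y _ => rI0 q y) (mrI q)).
  rewrite -YV -[leLHS]mul1e -integral_cst; last exact: measurable_cube.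
  apply: ge0_le_integral => //; first exact: measurable_cube.
    exact: emeasurable_funD.
  move=> y Yy; apply: le_trans (H (inner_point x0 r y) _) _.
    exact: inner_point_unit_ball (cube_enorm Yy).
  by rewrite IE; apply: leeD; exact: segment_integral_inner.
rewrite -leeBlDl// -EFinB; congr (_%:E <= _); lra.
Qed.

End ModulusLowerBoundLog.

(** * Integration over the radii against [dr / r] *)

Section LogarithmicLowerBound.
Context {R : realType} {m : nat}.
Local Notation n := m.+1.
Local Notation mu := (@lebesgue_measure R).
Local Notation nu := (borel_leb R n).
Local Notation alpha := (n%:R^-1 : R).
Local Open Scope ereal_scope.

Variable rho : 'rV[R]_n -> \bar R.
Hypotheses (mrho : borel_fun rho) (rho0 : forall x, 0 <= rho x).
Variable x0 : 'rV[R]_n.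

(** The integrand of the energies, weighted by [th^(alpha - 2)] and [1 / r], as one function of [r]
    and [z = (th, w)], so that the integral over [r] can be moved inside. *)
Definition shell_kernel (r : R) (z : R * 'rV[R]_n) : \bar R :=
  (if shell x0 r z.1 z.2 then r `^ (- 1) else 0)%:E *
  ((z.1 `^ (alpha - 2))%:E * rho z.2 ^+ n).

Lemma shell_kernel_ge0 r z : 0 <= shell_kernel r z.
Proof.
rewrite mule_ge0//; first by rewrite lee_fin; case: ifP => // _; exact: powR_ge0.
by rewrite mule_ge0 ?expe_ge0// lee_fin powR_ge0.
Qed.

Lemma measurable_shell_kernel :
  measurable_fun setT (fun u : measurableTypeR R * (measurableTypeR R * borelV R n) =>
    shell_kernel u.1 u.2).
Proof.
have m21 : measurable_fun setT
    (fun u : measurableTypeR R * (measurableTypeR R * borelV R n) => u.2.1).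
  exact: (measurableT_comp measurable_fst measurable_snd).
have m22 : measurable_fun setT
    (fun u : measurableTypeR R * (measurableTypeR R * borelV R n) => u.2.2).
  exact: (measurableT_comp measurable_snd measurable_snd).
apply: emeasurable_funM.
  apply/measurable_EFinP; apply: measurable_fun_ifT => //.
    by apply: measurable_shell.
  exact: (measurableT_comp (measurable_powR _) measurable_fst).
apply: emeasurable_funM.
  by apply/measurable_EFinP; exact: (measurableT_comp (measurable_powR _) m21).
by apply: measurable_fun_expe; exact: (measurableT_comp mrho m22).
Qed.

Lemma measurable_shell_kernel_at r :
  measurable_fun setT (shell_kernel r : measurableTypeR R * borelV R n -> \bar R).
Proof.
have m1 : measurable_fun setT
    (fun z : measurableTypeR R * borelV R n => (r : measurableTypeR R, z)).
  by apply: measurable_fun_pair.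
exact: (measurableT_comp measurable_shell_kernel m1).
Qed.

Lemma integral_energy_kernel (r : R) :
  (r `^ (- 1))%:E *
    \int[mu]_(th in `]0%R, 1%R]) ((th `^ (alpha - 2))%:E * energy rho x0 r th) =
  \int[sigma_finite_prod mu nu]_(z in `]0%R, 1%R] `*` setT) shell_kernel r z.
Proof.
rewrite (@tonelli_prod_restrict _ _ (measurableTypeR R) (borelV R n) R mu nu _ _ _
  (measurable_itv _) measurableT (measurable_shell_kernel_at r) (shell_kernel_ge0 r)).
have mE : measurable_fun (`]0%R, 1%R]%classic : set (measurableTypeR R))
    (fun th => (th `^ (alpha - 2))%:E * energy rho x0 r th).
  by apply: emeasurable_funM; [exact: measurable_powR_E | exact: measurable_energy].
have E0 th : 0 <= (th `^ (alpha - 2))%:E * energy rho x0 r th.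
  by rewrite mule_ge0 ?energy_ge0// lee_fin powR_ge0.
have r0 : 0 <= (r `^ (- 1))%:E by rewrite lee_fin powR_ge0.
rewrite -(@ge0_integralZl _ (measurableTypeR R) R mu _ (measurable_itv _) _ mE _
  (fun th _ => E0 th) r0).
apply: eq_integral => th _.
have [h hE] : exists h : 'rV[R]_n -> \bar R,
    h = fun w => if shell x0 r th w then rho w ^+ n else 0 by eexists.
have mh : measurable_fun setT (h : borelV R n -> \bar R).
  by rewrite hE; apply: measurable_shell_energy => //; exact: measurable_id.
have h0 w : 0 <= h w by rewrite hE; case: ifP => // _; exact: expe_ge0.
have th0 : 0 <= (r `^ (- 1) * th `^ (alpha - 2))%:E by rewrite lee_fin mulr_ge0 ?powR_ge0.
rewrite muleA -EFinM /energy -[in LHS]hE.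
rewrite -(@ge0_integralZl _ (borelV R n) R nu _ measurableT h mh _ (fun w _ => h0 w) th0).
apply: eq_integral => w _; rewrite hE /shell_kernel/=.
case: ifP => _; first by rewrite EFinM muleA.
by rewrite mule0 mul0e.
Qed.

(** For fixed [th] and [w], [integral_inv_shell] with [s = enorm (w - x0)] supplies the factor
    [96 * th] that makes the weight in [th] integrable. *)
Lemma integral_kernel_radius (a b : R) (z : R * 'rV[R]_n) : (0 < a)%R -> (0 < z.1 <= 1)%R ->
  \int[mu]_(r in `[a, b]) shell_kernel r z <=
  (96 * z.1 `^ (alpha - 1))%:E * rho z.2 ^+ n.
Proof.
case: z => th w /= a0 th01; have /andP[th0 th1] := th01.
have c0 : 0 <= (th `^ (alpha - 2))%:E * rho w ^+ n.
  by rewrite mule_ge0 ?expe_ge0// lee_fin powR_ge0.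
pose g (r : R) : \bar R := (if shell x0 r th w then r `^ (- 1) else 0)%:E.
have g0 r : 0 <= g r by rewrite lee_fin; case: ifP => // _; exact: powR_ge0.
have mg : measurable_fun (`[a, b]%classic : set (measurableTypeR R)) g.
  apply/measurable_EFinP; apply: measurable_funTS; apply: measurable_fun_ifT => //.
  by apply: measurable_shell.
rewrite (eq_integral (fun r : measurableTypeR R =>
  ((th `^ (alpha - 2))%:E * rho w ^+ n) * g r)); last first.
  by move=> r _; rewrite muleC.
rewrite (@ge0_integralZl _ (measurableTypeR R) R mu _ (measurable_itv _) g mg _
  (fun r _ => g0 r) c0).
apply: le_trans (lee_wpmul2l c0 (integral_inv_shell b a0 th01 (enorm_ge0 (w - x0)))) _.
rewrite muleAC -EFinM lee_wpmul2r ?expe_ge0// lee_fin.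
rewrite mulrA [X in (_ <= X)%R](_ : _ = 96 * (th `^ (alpha - 2) * th))%R.
  by rewrite mulrAC mulrC mulrA.
congr (_ * _)%R; rewrite -[X in (_ * X)%R]powRr1 ?(ltW th0)// -powRD; last first.
  by rewrite (gt_eqF th0) implybT.
by congr powR; ring.
Qed.

End LogarithmicLowerBound.

Section ModulusOfSegments.
Context {R : realType} {m : nat}.
Local Notation n := m.+1.
Local Notation mu := (@lebesgue_measure R).
Local Notation nu := (borel_leb R n).
Local Notation alpha := (n%:R^-1 : R).
Local Open Scope ereal_scope.

Lemma integral_kernel_le (rho : 'rV[R]_n -> \bar R) (x0 : 'rV[R]_n) (a b : R) :
  borel_fun rho -> (forall x, 0 <= rho x) -> (0 < a)%R ->
  \int[mu]_(r in `[a, b])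
    \int[sigma_finite_prod mu nu]_(z in `]0%R, 1%R] `*` setT) shell_kernel rho x0 r z <=
  (96 * n%:R)%:E * \int[nu]_w rho w ^+ n.
Proof.
move=> mrho rho0 a0.
have mD : measurable (`]0%R, 1%R]%classic `*` setT : set (measurableTypeR R * borelV R n)).
  by apply: measurableX.
rewrite (@tonelli_restrict _ _ (measurableTypeR R) (measurableTypeR R * borelV R n)%type R
  mu (sigma_finite_prod mu nu) _ _ (fun u => shell_kernel rho x0 u.1 u.2)
  (measurable_itv _) mD (measurable_shell_kernel mrho x0)
  (fun u => shell_kernel_ge0 rho0 x0 u.1 u.2)).
pose J (z : measurableTypeR R * borelV R n) : \bar R :=
  (96 * z.1 `^ (alpha - 1))%:E * rho z.2 ^+ n.
have J0 z : 0 <= J z.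
  by rewrite mule_ge0 ?expe_ge0// lee_fin mulr_ge0 ?powR_ge0.
have mrhon : measurable_fun setT (fun w : borelV R n => rho w ^+ n).
  exact: measurable_fun_expe.
have mJ : measurable_fun setT J.
  apply: emeasurable_funM.
    apply/measurable_EFinP; apply: measurable_funM => //.
    exact: (measurableT_comp (measurable_powR _) measurable_fst).
  exact: (measurableT_comp mrhon measurable_snd).
apply: (@le_trans _ _ (\int[sigma_finite_prod mu nu]_(z in `]0%R, 1%R] `*` setT) J z)).
  apply: ge0_le_integral => //.
  - move=> z _; apply: integral_ge0 => r _; exact: shell_kernel_ge0.
  - have := @measurable_fun_int1 _ _ (measurableTypeR R) (measurableTypeR R * borelV R n)%type R
      mu _ _ (fun u => shell_kernel rho x0 u.1 u.2)
      (measurable_itv `[a, b]) mD (measurable_shell_kernel mrho x0)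
      (fun u => shell_kernel_ge0 rho0 x0 u.1 u.2).
    exact.
  - exact: measurable_funTS.
  - move=> z [/= + _]; rewrite in_itv/= => th01.
    exact: integral_kernel_radius.
rewrite (@tonelli_prod_restrict _ _ (measurableTypeR R) (borelV R n) R mu nu _ _ _
  (measurable_itv _) measurableT mJ J0).
have e0 : 0 <= \int[nu]_w rho w ^+ n by apply: integral_ge0 => w _; exact: expe_ge0.
rewrite (eq_integral (fun th : measurableTypeR R =>
    (96%:E * \int[nu]_w rho w ^+ n) * (th `^ (alpha - 1))%:E)); last first.
  move=> th _; rewrite /J/=.
  have c0 : 0 <= (96 * th `^ (alpha - 1))%:E by rewrite lee_fin mulr_ge0 ?powR_ge0.
  rewrite (@ge0_integralZl _ (borelV R n) R nu _ measurableT _ mrhon _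
    (fun w _ => expe_ge0 n (rho0 w)) c0).
  by rewrite EFinM muleAC.
have p0 th : 0 <= (th `^ (alpha - 1))%:E by rewrite lee_fin powR_ge0.
have c0 : 0 <= 96%:E * \int[nu]_w rho w ^+ n by rewrite mule_ge0// lee_fin.
rewrite (@ge0_integralZl _ (measurableTypeR R) R mu _ (measurable_itv _) _
  (@measurable_powR_E _ (alpha - 1) _) _ (fun th _ => p0 th) c0).
have h : \int[mu]_(th in `]0%R, 1%R]) (th `^ (alpha - 1))%:E <= n%:R%:E.
  by have := @integral_powR_le R alpha; rewrite invr_gt0 invrK; exact.
apply: le_trans (lee_wpmul2l c0 h) _.
by rewrite muleAC -EFinM.
Qed.

(** [energy_lower_bound] divided by [r] and integrated over [[a, b]]. The functions [p] and [q] are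
    arbitrary: they have disappeared from the estimate before [r] is integrated. *)
Lemma modulus_log_lower_bound :
  exists2 c : R, (0 < c)%R &
  forall (x0 : 'rV[R]_n) (p q : R -> 'rV[R]_n) (a b : R) (rho : 'rV[R]_n -> \bar R),
  enorm x0 = 1%R -> (0 < a)%R -> (a < b)%R -> (b <= 1)%R ->
  (forall r, (a <= r <= b)%R -> [/\ (enorm (p r) < 1)%R, enorm (p r - x0) = r,
     (enorm (q r) < 1)%R & enorm (q r - x0) = r]) ->
  borel_fun rho -> (forall x, 0 <= rho x) ->
  (forall r z, (a <= r <= b)%R -> (enorm z < 1)%R ->
    1 <= segment_integral rho (p r) z + segment_integral rho (q r) z) ->
  (c * ln (b / a))%:E <= \int[@leb R n]_x rho x ^+ n.
Proof.
have [V V0 YV] := @cube_volume R m.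
have n0 : (0 < n%:R :> R)%R by rewrite ltr0n.
pose C4 : R := (4 * (8 * n%:R) ^+ m)%R.
have C40 : (0 < C4)%R by rewrite mulr_gt0// exprn_gt0// mulr_gt0.
have C0 : (0 < 96 * n%:R :> R)%R by rewrite mulr_gt0.
(* [V / 2] and [C4] come from [energy_lower_bound], [96 * n] from [integral_kernel_le]. *)
exists ((V / 2) / (C4 * (96 * n%:R)))%R; first by rewrite !divr_gt0// mulr_gt0.
move=> x0 p q a b rho x01 a0 ab b1 pq mrho rho0 H.
rewrite integral_borel_leb; last 2 first.
- by have := @measurable_fun_expe R _ (borelV R n) setT rho n mrho.
- by move=> x; exact: expe_ge0.
have [S SE] : exists S : R -> \bar R, S = fun r =>
  \int[sigma_finite_prod mu nu]_(z in `]0%R, 1%R] `*` setT) shell_kernel rho x0 r z by eexists.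
have S0 r : 0 <= S r.
  by rewrite SE; apply: integral_ge0 => z _; exact: shell_kernel_ge0.
have mS : measurable_fun (`[a, b]%classic : set (measurableTypeR R)) S.
  rewrite SE.
  have mD : measurable (`]0%R, 1%R]%classic `*` setT : set (measurableTypeR R * borelV R n)).
    by apply: measurableX.
  have := @measurable_fun_int2 _ _ (measurableTypeR R) (measurableTypeR R * borelV R n)%type R
    (sigma_finite_prod mu nu) _ _ (fun u => shell_kernel rho x0 u.1 u.2)
    (measurable_itv `[a, b]) mD (measurable_shell_kernel mrho x0)
    (fun u => shell_kernel_ge0 rho0 x0 u.1 u.2).
  exact.
have C40' : 0 <= C4%:E by rewrite lee_fin ltW.
have key : (V / 2)%:E * (ln (b / a))%:E <= C4%:E * \int[mu]_(r in `[a, b]) S r.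
  rewrite -integral_inv//.
  have minv : measurable_fun (`[a, b]%classic : set (measurableTypeR R))
      (fun r => (r^-1)%:E : \bar R).
    apply: (@eq_measurable_fun _ _ _ _ _ (fun r : measurableTypeR R => (r `^ (- 1))%:E)).
      move=> r; rewrite inE/= in_itv/= => /andP[ar _].
      by rewrite powR_inv1// ltW// (lt_le_trans a0).
    exact: measurable_powR_E.
  have inv0 (r : R) : `[a, b]%classic r -> 0 <= (r^-1)%:E :> \bar R.
    rewrite /= in_itv/= => /andP[ar _].
    by rewrite lee_fin invr_ge0 (le_trans (ltW a0)).
  have V2 : 0 <= (V / 2)%:E by rewrite lee_fin divr_ge0// ltW.
  rewrite -(@ge0_integralZl _ (measurableTypeR R) R mu _ (measurable_itv _) _ minv _ inv0 V2).
  rewrite -(@ge0_integralZl _ (measurableTypeR R) R mu _ (measurable_itv _) _ mS _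
    (fun r _ => S0 r) C40').
  apply: ge0_le_integral => //.
  - by move=> r /inv0 r0; rewrite mule_ge0.
  - exact: measurable_funeM.
  - exact: measurable_funeM.
  - move=> r /=; rewrite in_itv/= => arb; have /andP[ar rb] := arb.
    have r0 : (0 < r)%R := lt_le_trans a0 ar.
    have [p1 pr q1 qr] := pq r arb.
    have r01 : (0 < r <= 1)%R by rewrite r0 (le_trans rb).
    have := energy_lower_bound mrho rho0 YV x01 r01 p1 pr q1 qr (fun z => H r z arb).
    rewrite SE -integral_energy_kernel// powR_inv1 ?(ltW r0)// => h.
    have r0' : 0 <= r^-1%:E by rewrite lee_fin invr_ge0 ltW.
    rewrite [leLHS]muleC; apply: le_trans (lee_wpmul2l r0' h) _.
    by rewrite muleCA.
have key2 : \int[mu]_(r in `[a, b]) S r <= (96 * n%:R)%:E * \int[nu]_w rho w ^+ n.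
  by rewrite SE; exact: integral_kernel_le.
have := le_trans key (lee_wpmul2l C40' key2).
rewrite muleA -!EFinM => key3.
have C0' : (0 < C4 * (96 * n%:R))%R by rewrite mulr_gt0.
rewrite -(@lee_pmul2l _ (C4 * (96 * n%:R))%:E)// ?lte_fin//.
apply: le_trans key3; rewrite -EFinM lee_fin le_eqVlt; apply/orP; left; apply/eqP.
by rewrite [LHS]mulrA; congr (_ * _)%R; rewrite mulrC divfK// gt_eqF.
Qed.

End ModulusOfSegments.

(** * Preimages of continua under open and closed maps *)

Section ContinuaPreimages.
Context {R : realType} {n : nat}.

(* An open and closed map sends the part of [f^-1 K] inside the sphere onto a
   clopen part of [K], so [f^-1 K] cannot avoid the sphere before meeting [f^-1 A]. *)
Lemma preimage_meets_sphere (f : 'rV[R]_n -> 'rV[R]_n) (A K : set 'rV[R]_n)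
    (x x0 : 'rV[R]_n) (r : R) :
  {within unit_ball, continuous f} -> open_on unit_ball f ->
  closed_between unit_ball unit_ball f ->
  connected K -> closed K -> K `<=` unit_ball -> K `&` A !=set0 ->
  unit_ball x -> K (f x) -> enorm (x - x0) < r ->
  (forall w, unit_ball w -> A (f w) -> r <= enorm (w - x0)) ->
  exists p, [/\ unit_ball p, enorm (p - x0) = r & K (f p)].
Proof.
move=> cf of_ clf cK clK KB [a [Ka Aa]] Bx Kx xr far.
apply: contrapT => /forallNP noP.
pose E := [set w | [/\ unit_ball w, K (f w) & enorm (w - x0) <= r]].
have Elt w : E w -> enorm (w - x0) < r.
  by move=> [Bw Kw wr]; rewrite lt_neqAle wr andbT; apply/eqP => wr'; exact: (noP w).
have EB : E `<=` unit_ball by move=> w [].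
have [C1 cC1 EC1] : closed_in unit_ball E.
  have /continuous_closedP/(_ K clK) : continuous (f : subspace unit_ball -> _) by [].
  move=> /closed_subspaceP[C cC CE].
  exists (C `&` [set w | enorm (w - x0) <= r]).
    by apply: closedI => //; exact: closed_edist_le.
  apply/seteqP; split => w.
    move=> [Bw Kw wr]; split => //; split => //.
    have : (C `&` unit_ball) w by rewrite CE.
    by move=> [].
  move=> [Bw [Cw wr]]; split => //.
  have : (C `&` unit_ball) w by [].
  by rewrite CE => -[].
have [C2 cC2 fEC2] : closed_in unit_ball (f @` E).
  by apply: clf => //; exists C1.
have oU : open (f @` (unit_ball `&` eball x0 r)).
  apply: of_; first by move=> w [].
  by apply: openI; exact: open_eball.
have fEK : f @` E `<=` K by move=> _ [w [_ Kw _] <-].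
have : f @` E = K.
  apply: cK.
  - by exists (f x), x => //; split => //; exact: ltW.
  - exists (f @` (unit_ball `&` eball x0 r)) => //.
    apply/seteqP; split => y.
      move=> Ey; split; first exact: fEK.
      by case: Ey => w Ew <-; exists w => //; split; [exact: EB | exact: Elt].
    by move=> [Ky [w [Bw /ltW wr] wy]]; exists w => //; split => //; rewrite wy.
  - exists C2 => //; apply/seteqP; split => y.
      by move=> Ey; split; [exact: fEK | move: Ey; rewrite fEC2 => -[]].
    by move=> [Ky Cy]; rewrite fEC2; split => //; exact: KB.
move=> fE; move: (Ka); rewrite -fE => -[w Ew wa].
have := far w (EB _ Ew); rewrite wa => /(_ Aa).
by rewrite leNgt Elt.
Qed.

End ContinuaPreimages.

(** * The family of segments and the upper bound for its modulus *)

Section SegmentFamily.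
Context {R : realType} {n : nat}.
Local Open Scope ereal_scope.

Definition separated_segments (f : 'rV[R]_n -> 'rV[R]_n) (eta : R) : set (@Defs.path R n) :=
  [set g | exists p z, [/\ unit_ball p, unit_ball z, (eta <= enorm (f z - f p))%R &
     g = Path `[0%R, 1%R] (fun t => p + t *: (z - p))%R]].

Lemma curve_length_ge (a b : R) (g : R -> 'rV[R]_n) : (a < b)%R ->
  (enorm (g b - g a))%:E <= curve_length a b g.
Proof.
move=> ab; apply: ereal_sup_ubound; exists [:: b].
  by split => //=; rewrite ?ab.
by rewrite polygonal_length_cons /polygonal_length/= big_geq// addr0.
Qed.

Lemma separated_segments_admissible (f : 'rV[R]_n -> 'rV[R]_n) (eta : R) : (0 < eta)%R ->
  admissible (path_comp f @` separated_segments f eta) (fun=> (eta^-1)%:E).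
Proof.
move=> eta0; split.
- by move=> _; rewrite lee_fin invr_ge0 ltW.
- exact: measurable_cst.
move=> _ [_ [p [z [Bp Bz h ->]]] <-] lr.
set g := path_comp _ _ in lr *.
(* The domain is itself a closed subinterval, so a locally rectifiable image path has finite length,
   at least the distance [eta] of its ends. *)
have p01 : closed_subinterval (path_dom g) (0%R, 1%R).
  by split; rewrite /= ?in_itv/= ?lexx ?ler01.
have := lr _ p01; rewrite /= => lfin.
apply: (@le_trans _ _ (arclength_integral (fun=> (eta^-1)%:E) 0 1 (Defs.path_map g))); last first.
  by apply: ereal_sup_ubound; exists (0%R, 1%R).
have l1 := @curve_length_ge 0 1 (Defs.path_map g) ltr01.
rewrite /= scale1r scale0r addr0 subrKC in l1.
have l0 : 0 <= curve_length 0 1 (Defs.path_map g) by apply: le_trans l1; rewrite lee_fin enorm_ge0.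
have lf : curve_length 0 1 (Defs.path_map g) \is a fin_num by rewrite ge0_fin_numE.
rewrite /arclength_integral integral_cst//.
have len : lebesgue_measure (`[0%R, fine (curve_length 0 1 (Defs.path_map g))]%classic : set R) =
    curve_length 0 1 (Defs.path_map g).
  rewrite lebesgue_measure_itv/= lte_fin; case: ifPn => [_|].
    by rewrite sube0 fineK.
  rewrite -leNgt => le0; have h0 : fine (curve_length 0 1 (Defs.path_map g)) = 0%R.
    by apply/eqP; rewrite eq_le le0 fine_ge0.
  by rewrite -[RHS]fineK// h0.
rewrite [X in _ * X](_ : _ = curve_length 0 1 (Defs.path_map g)); last exact: len.
rewrite muleC -lee_pdivrMr ?invr_gt0// ?mul1e ?invrK.
by apply: le_trans l1; rewrite lee_fin.
Qed.

Lemma separated_segments_sub (f : 'rV[R]_n -> 'rV[R]_n) (eta : R) :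
  separated_segments f eta `<=`
    [set gamma | path_in unit_ball gamma /\ locally_rectifiable gamma].
Proof.
move=> _ [p [z [Bp Bz h ->]]]; split; last first.
  by move=> [a b] [_ _ /= ab]; rewrite curve_length_affine// ltry.
split.
  split; first by exists 0%R; rewrite /= in_itv/= lexx ler01.
  by apply: continuous_subspaceT; exact: continuous_affine.
by move=> t; rewrite /= in_itv/= => t01; exact: unit_ball_convex.
Qed.

Lemma modulus_separated_segments_le (f : 'rV[R]_n -> 'rV[R]_n) (Q : 'rV[R]_n -> \bar R) (eta : R) :
  (0 < eta)%R -> f @` unit_ball = unit_ball -> inverse_poletsky unit_ball f Q ->
  (forall x, unit_ball x -> 0 <= Q x) -> (@leb R n).-integrable unit_ball Q ->
  modulus (separated_segments f eta) <= (L1_norm unit_ball Q / eta ^+ n)%:E.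
Proof.
move=> eta0 fB fQ Q0 iQ.
apply: (le_trans (fQ _ (@separated_segments_sub f eta) _ (separated_segments_admissible f eta0))).
rewrite fB -EFin_expe; have /integrableP[mQ Qoo] := iQ.
have mB : measurable (unit_ball : set (caratheodory_type (@lebesgue_outer R n))).
  by apply: borel_lebesgue; apply: open_borel; exact: open_unit_ball.
have c0 : 0 <= (eta^-1 ^+ n)%:E by rewrite lee_fin exprn_ge0// invr_ge0 ltW.
rewrite (eq_integral (fun y : caratheodory_type (@lebesgue_outer R n) =>
    (eta^-1 ^+ n)%:E * `|Q y|)); last first.
  by move=> y; rewrite inE => By; rewrite muleC gee0_abs// Q0.
have mQa : measurable_fun
    (unit_ball : set (caratheodory_type (@lebesgue_outer R n))) (fun y => `|Q y|).
  exact: measurableT_comp.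
rewrite (@ge0_integralZl _ _ _ _ _ mB _ mQa _ (fun y _ => abse_ge0 _) c0).
rewrite /L1_norm EFinM fineK; first by rewrite muleC exprVn.
by rewrite ge0_fin_numE// integral_ge0.
Qed.

End SegmentFamily.

(** * Two continua joining given points to [A] at a controlled distance *)

Section SeparatingContinua.
Context {R : realType} {n : nat}.
Implicit Types (a e u v w x y om : 'rV[R]_n).

(** Here dimension at least 2 enters: if two basis vectors were both multiples of [e] in the
    required way, [e] would have two coordinates of square 1. The sign of [om] is free and is chosen
    according to [w]. *)
Lemma orthogonal_unit e w : (2 <= n)%N -> enorm e = 1 ->
  exists om, [/\ enorm om = 1, dot e om = 0 & dot w om <= 0].
Proof.
move=> n2 e1.
have ee : dot e e = 1 by rewrite -enorm_sqr e1 expr1n.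
pose i0 : 'I_n := Ordinal (ltnW n2); pose i1 : 'I_n := Ordinal n2.
pose b i : 'rV[R]_n := \row_j (j == i)%:R.
have dotb x i : dot x (b i) = x ord0 i.
  rewrite /dot (bigD1 i)//= !mxE eqxx mulr1 big1 ?addr0// => j /negbTE ji.
  by rewrite !mxE ji mulr0.
suff [y y0 ey] : exists2 y, y != 0 & dot e y = 0.
  have y0' := enorm_gt0 y0.
  pose om := (enorm y)^-1 *: y.
  have om1 : enorm om = 1 by rewrite enormZ ger0_norm ?invr_ge0 ?enorm_ge0// mulVf// gt_eqF.
  have eom : dot e om = 0 by rewrite dotZr ey mulr0.
  have [wo|wo] := leP (dot w om) 0; first by exists om.
  by exists (- om); rewrite enormN !dotNr eom oppr0 oppr_le0 ltW.
have c i : dot e (b i - e ord0 i *: e) = 0 by rewrite dotBr dotZr ee dotb mulr1 subrr.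
have [z0|z0] := eqVneq (b i0 - e ord0 i0 *: e) 0; last by exists (b i0 - e ord0 i0 *: e).
have [z1|z1] := eqVneq (b i1 - e ord0 i1 *: e) 0; last by exists (b i1 - e ord0 i1 *: e).
have h0 : e ord0 i0 ^+ 2 = 1.
  by move/rowP: z0 => /(_ i0); rewrite !mxE eqxx => /eqP; rewrite subr_eq0 -expr2 => /eqP.
have h1 : e ord0 i1 ^+ 2 = 1.
  by move/rowP: z1 => /(_ i1); rewrite !mxE eqxx => /eqP; rewrite subr_eq0 -expr2 => /eqP.
have : 1 + 1 <= dot e e.
  rewrite /dot (bigD1 i0)//= (bigD1 i1)//= -!expr2 h0 h1 addrA lerDl.
  by apply: sumr_ge0 => j _; rewrite -expr2 sqr_ge0.
by rewrite ee => h; exfalso; move: h; lra.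
Qed.

(** The set of points at distance at least [c] from the segment between [a] and [a - l *: e]; [e]
    points out of that segment at [a]. *)
Definition far_from a e (l c : R) : set 'rV[R]_n :=
  [set x | forall s, 0 <= s <= l -> c <= enorm (x - (a - s *: e))].

Lemma far_from_le a e l c c' x : c <= c' -> far_from a e l c' x -> far_from a e l c x.
Proof. by move=> cc' h s sl; apply: le_trans cc' (h s sl). Qed.

Lemma dot_segment_ge a om c x y z : c <= dot (x - a) om -> c <= dot (y - a) om ->
  segment x y z -> c <= dot (z - a) om.
Proof.
move=> xc yc [t + <-]; rewrite /= in_itv/= => /andP[t0 t1].
have -> : x + t *: (y - x) - a = (1 - t) *: (x - a) + t *: (y - a).
  by apply/rowP => i; rewrite !mxE; ring.
rewrite dotDl !dotZl.
have h1 : (1 - t) * c <= (1 - t) * dot (x - a) om by rewrite ler_wpM2l// subr_ge0.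
have h2 : t * c <= t * dot (y - a) om by rewrite ler_wpM2l.
lra.
Qed.

Lemma dot_unit_le x e : enorm e = 1 -> dot x e <= enorm x.
Proof. by move=> e1; rewrite (le_trans (dot_le_enorm _ _))// e1 mulr1. Qed.

Lemma dot_unit_ge x e : enorm e = 1 -> - enorm x <= dot x e.
Proof. by move=> e1; rewrite lerNl -dotNl -[leRHS](enormN x) dot_unit_le. Qed.

(** This lemma and the next two give half-spaces contained in [far_from]. By convexity a segment
    with both ends in one of them stays there. *)
Lemma far_from_lateral a e l om c x : enorm om = 1 -> dot e om = 0 ->
  c <= dot (x - a) om -> far_from a e l c x.
Proof.
move=> om1 eom xc s _; apply: le_trans xc _.
rewrite -[leLHS]addr0 -(mulr0 s) -eom -dotZl -dotDl.
by apply: le_trans (dot_unit_le _ om1) _; rewrite opprB addrAC -addrA [s *: e - a]addrC addrA.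
Qed.

Lemma far_from_ahead a e l c x : enorm e = 1 ->
  c <= dot (x - a) e -> far_from a e l c x.
Proof.
move=> e1 xc s /andP[s0 _]; have ee : dot e e = 1 by rewrite -enorm_sqr e1 expr1n.
apply: le_trans (dot_unit_le _ e1).
have -> : x - (a - s *: e) = (x - a) + s *: e by rewrite opprB addrCA addrC.
by rewrite dotDl dotZl ee mulr1; apply: le_trans xc _; rewrite lerDl.
Qed.

Lemma far_from_behind a e l c x : enorm e = 1 ->
  c <= dot (x - a) (- e) - l -> far_from a e l c x.
Proof.
move=> e1 xc s /andP[_ sl]; have ee : dot e e = 1 by rewrite -enorm_sqr e1 expr1n.
have e1' : enorm (- e) = 1 by rewrite enormN.
apply: le_trans (dot_unit_le _ e1').
have -> : x - (a - s *: e) = (x - a) + s *: e by rewrite opprB addrCA addrC.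
rewrite dotDl dotZl [dot e _]dotNr ee mulrN1; lra.
Qed.

(** Leads [w] around the segment into the half-space ahead of [a], where the continua built from
    different points can be joined to each other. The bound [8 * h <= kappa] leaves room in the ball
    ahead of [a]. *)
Lemma escape_continuum a e (l kappa h : R) w : (2 <= n)%N -> enorm e = 1 -> 0 <= l ->
  enorm a <= 1 - kappa -> kappa <= 1 -> 0 < h -> 8 * h <= kappa -> enorm w < 1 ->
  far_from a e l h w ->
  exists K : set 'rV[R]_n, [/\ compact K, connected K, K `<=` unit_ball,
    K `<=` far_from a e l (h / 8) &
    K w /\ exists2 p, K p & h / 8 <= dot (p - a) e].
Proof.
move=> n2 e1 l0 ak k1 h0 hk w1 wfar.
have ee : dot e e = 1 by rewrite -enorm_sqr e1 expr1n.
have Bw : unit_ball w by rewrite unit_ballE.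
pose al := dot (w - a) e; pose y := (w - a) - al *: e; pose be := enorm y.
have wE : w - a = al *: e + y by rewrite /y subrKC.
have ey : dot e y = 0 by rewrite /y dotBr dotZr ee mulr1 dotC subrr.
have [alh|alh] := leP (h / 8) al.
  exists [set w]; split => //.
  - exact: compact_set1.
  - exact: connected1.
  - by move=> _ ->.
  - by move=> _ ->; apply: far_from_le wfar; lra.
  - by split => //; exists w.
have target om : enorm om = 1 -> dot e om = 0 ->
    let p := a + h *: e + (h / 8) *: om in
    [/\ unit_ball p, dot (p - a) om = h / 8 & h / 8 <= dot (p - a) e].
  move=> om1 eom p; have oo : dot om om = 1 by rewrite -enorm_sqr om1 expr1n.
  have pE : p - a = h *: e + (h / 8) *: om by rewrite /p; apply/rowP => i; rewrite !mxE; ring.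
  rewrite pE !dotDl !dotZl eom oo ee (dotC om) eom unit_ballE; split; try lra.
  rewrite /p -addrA; apply: le_lt_trans (enormD _ _) _.
  have : enorm (h *: e + (h / 8) *: om) <= h + h / 8.
    apply: le_trans (enormD _ _) _; rewrite !enormZ e1 om1 !mulr1 !ger0_norm//; lra.
  lra.
(* If [w] is at distance at least [h / 4] from the line of the segment, a straight segment in the
   half-space on its side of that line will do. *)
have [beh|beh] := leP (h / 4) be.
  have be0 : 0 < be by lra.
  pose om := be^-1 *: y.
  have om1 : enorm om = 1 by rewrite enormZ ger0_norm ?invr_ge0 ?(ltW be0)// mulVf// gt_eqF.
  have eom : dot e om = 0 by rewrite dotZr ey mulr0.
  have wom : dot (w - a) om = be.
    by rewrite wE dotDl dotZl eom mulr0 add0r dotZr -enorm_sqr expr2 mulrA mulVf ?mul1r// gt_eqF.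
  have [Bp pom pe] := target om om1 eom.
  exists (segment w (a + h *: e + (h / 8) *: om)); split.
  - exact: segment_compact.
  - exact: segment_connected.
  - exact: segment_unit_ball.
  - move=> z wz; apply: (@far_from_lateral a e l om (h / 8) z om1 eom).
    apply: dot_segment_ge wz; rewrite ?wom ?pom//; lra.
  - split; first exact: segment_left.
    by exists (a + h *: e + (h / 8) *: om) => //; exact: segment_right.
(* Here [w] lies behind the endpoint [a - l e]: step aside first. *)
have albe : al <= - l - 3 * h / 4.
  have [al0|al0] := leP 0 al.
    have := wfar 0; rewrite lexx l0 => /(_ isT); rewrite scale0r subr0 wE => hw.
    have := enormD (al *: e) y; rewrite enormZ e1 mulr1 ger0_norm// -/be; lra.
  have [all_|all_] := leP (- l) al.
    have := wfar (- al); rewrite oppr_ge0 (ltW al0) lerNl all_ => /(_ isT).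
    rewrite (_ : w - _ = y); first by rewrite -/be; lra.
    by rewrite /y; apply/rowP => i; rewrite !mxE; ring.
  have := wfar l; rewrite l0 lexx => /(_ isT).
  rewrite (_ : w - _ = (al + l) *: e + y); last first.
    by rewrite /y; apply/rowP => i; rewrite !mxE; ring.
  move=> hw; have := enormD ((al + l) *: e) y; rewrite enormZ e1 mulr1 ltr0_norm -/be; lra.
have [om [om1 eom wom]] := orthogonal_unit w n2 e1.
have oo : dot om om = 1 by rewrite -enorm_sqr om1 expr1n.
(* The sidestep [W] may leave the ball, but [dot w om <= 0] keeps its squared norm below [1 + t^2].
   Shrinking by [1 - t^2 / 2] brings it back, as [(1 - q / 2)^2 * (1 + q) <= 1] for [q = t^2], and
   moves it by at most [t^2 <= h / 32]. *)
pose t := h / 2; pose W := w + t *: om; pose w1' := (1 - t ^+ 2 / 2) *: W.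
have t0 : 0 < t by rewrite /t; lra.
have t16 : t <= 1 / 16 by rewrite /t; lra.
have tt : t ^+ 2 <= h / 32.
  by rewrite expr2 (_ : h / 32 = t * (1 / 16)) ?ler_wpM2l ?(ltW t0)// /t; field.
have tt0 : 0 <= t ^+ 2 by rewrite sqr_ge0.
have W2 : enorm W <= 2.
  by apply: le_trans (enormD _ _) _; rewrite enormZ om1 mulr1 gtr0_norm//; lra.
have Wo := dot_unit_le W om1; have We := dot_unit_ge W e1.
have w1E : w1' - a = (w - a) + t *: om - (t ^+ 2 / 2) *: W.
  by rewrite /w1' /W; apply/rowP => i; rewrite !mxE; ring.
have Bw1 : unit_ball w1'.
  rewrite unit_ballE -(ltr_pXn2r (n := 2)) ?nnegrE ?enorm_ge0// expr1n enorm_sqr.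
  rewrite /w1' dotZl dotZr.
  have WW : dot W W <= dot w w + t ^+ 2.
    rewrite /W !dotE oo (dotC om) mulr1 -expr2.
    have : t * dot w om <= 0 by rewrite mulr_ge0_le0// ltW.
    lra.
  have ww : dot w w < 1 by rewrite -enorm_sqr expr_lt1// enorm_ge0.
  set q := t ^+ 2 in tt tt0 WW *.
  have q1 : q <= 1 / 2 by lra.
  have c0 : 0 < (1 - q / 2) ^+ 2 by rewrite exprn_gt0//; lra.
  rewrite mulrA -expr2; apply: (@lt_le_trans _ _ ((1 - q / 2) ^+ 2 * (1 + q))).
    by rewrite ltr_pM2l//; lra.
  have : 0 <= q ^+ 2 * (3 - q) by rewrite mulr_ge0 ?sqr_ge0//; lra.
  rewrite !expr2; lra.
have yo : - be <= dot y om := dot_unit_ge y om1.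
have wo : dot (w - a) om = dot y om by rewrite wE dotDl dotZl eom mulr0 add0r.
have w1o : h / 8 <= dot (w1' - a) om.
  rewrite w1E dotBl dotDl wo !dotZl oo.
  have : t ^+ 2 / 2 * dot W om <= t ^+ 2 / 2 * 2 by rewrite ler_wpM2l//; lra.
  rewrite -/t in tt *; move: (t ^+ 2) tt => q; rewrite /t; lra.
have w1e : h / 8 <= dot (w1' - a) (- e) - l.
  rewrite dotNr w1E dotBl dotDl -/al !dotZl (dotC om) eom.
  have : t ^+ 2 / 2 * (- dot W e) <= t ^+ 2 / 2 * 2 by rewrite ler_wpM2l//; lra.
  move: (t ^+ 2) tt => q; lra.
have we : h / 8 <= dot (w - a) (- e) - l by rewrite dotNr -/al; lra.
have [Bp pom pe] := target om om1 eom.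
exists (segment w w1' `|` segment w1' (a + h *: e + (h / 8) *: om)); split.
- by apply: compactU; exact: segment_compact.
- apply: connectedU; [|exact: segment_connected|exact: segment_connected].
  by exists w1'; split; [exact: segment_right | exact: segment_left].
- by rewrite subUset; split; exact: segment_unit_ball.
- move=> z [wz|wz].
    apply: far_from_behind => //.
    have : l + h / 8 <= dot (z - a) (- e) by apply: dot_segment_ge wz; lra.
    lra.
  apply: (@far_from_lateral a e l om (h / 8) z om1 eom).
  by apply: dot_segment_ge wz => //; rewrite pom.
- split; first by left; exact: segment_left.
  by exists (a + h *: e + (h / 8) *: om) => //; right; exact: segment_right.
Qed.

End SeparatingContinua.

Section SeparatingContinuaInBall.
Context {R : realType} {n : nat}.
Implicit Types (A K : set 'rV[R]_n) (a e u v w x y : 'rV[R]_n).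

Definition continuum_to A u K : Prop :=
  [/\ closed K, connected K, K `<=` unit_ball, K `&` A !=set0 & K u].

(* [u] is joined by a straight segment to its nearest point [a] of [A]; both [v] and
   the points of [A] far from [a] then stay away from this segment. *)
Lemma separating_continua_nearest A (a1 a2 a u v : 'rV[R]_n) (kappa h : R) : (2 <= n)%N ->
  A `<=` unit_ball -> A a1 -> A a2 -> a1 <> a2 -> A a ->
  (forall x, A x -> enorm x <= 1 - kappa) -> kappa <= 1 ->
  (forall x, A x -> enorm (a - u) <= enorm (x - u)) ->
  (forall x, A x -> enorm (a - u) <= enorm (x - v)) ->
  unit_ball u -> unit_ball v ->
  0 < h -> h <= enorm (u - v) / 2 -> h <= enorm (a1 - a2) / 4 -> 8 * h <= kappa ->
  exists K1 K2, [/\ continuum_to A u K1, continuum_to A v K2 &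
    forall x y, K1 x -> K2 y -> h / 8 <= enorm (x - y)].
Proof.
move=> n2 AB Aa1 Aa2 a12 Aa Ak k1 near_u near_v Bu Bv h0 hu ha hk.
pose l := enorm (a - u); have l0 : 0 <= l := enorm_ge0 _.
have [e e1 eE] : exists2 e, enorm e = 1 & a - u = l *: e.
  have [au|au] := eqVneq (a - u) 0.
    (* Here [u = a], so [l = 0] and any unit vector can serve as [e]. *)
    have d0 : 0 < enorm (a1 - a2).
      by apply: enorm_gt0; rewrite subr_eq0; apply/eqP.
    exists ((enorm (a1 - a2))^-1 *: (a1 - a2)); last by rewrite /l au enorm0 scale0r.
    by rewrite enormZ ger0_norm ?invr_ge0 ?(ltW d0)// mulVf// gt_eqF.
  have lp : 0 < l by exact: enorm_gt0.
  exists (l^-1 *: (a - u)); last by rewrite scalerA divff ?scale1r// gt_eqF.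
  by rewrite enormZ ger0_norm ?invr_ge0// mulVf// gt_eqF.
have uE : u = a - l *: e by rewrite -eE opprB addrC subrK.
have s_a y s : 0 <= s -> enorm (y - a) - s <= enorm (y - (a - s *: e)).
  move=> s0; have := enorm_triangle (a - s *: e) y a.
  rewrite [a - s *: e - a]addrAC subrr add0r enormN enormZ e1 mulr1 ger0_norm//; lra.
have s_u y s : s <= l -> enorm (y - u) - (l - s) <= enorm (y - (a - s *: e)).
  move=> sl; have := enorm_triangle (a - s *: e) y u.
  rewrite {2}uE (_ : a - s *: e - (a - l *: e) = (l - s) *: e); last first.
    by apply/rowP => i; rewrite !mxE; ring.
  rewrite enormZ e1 mulr1 ger0_norm ?subr_ge0//; lra.
(* The distance from [v] to [a - s *: e] is at least [|v - a| - s >= l - s] and at least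
   [|v - u| - (l - s)]; the mean of the two bounds is [|v - u| / 2]. For [b] below, [|b - u| >= l]
   gives the mean [|b - a| / 2] in the same way. *)
have vfar : far_from a e l h v.
  move=> s /andP[s0 sl]; have := s_a v s s0; have := s_u v s sl.
  have := near_v a Aa; rewrite -/l (enormB a v) (enormB u v) in hu *; lra.
have [b Ab ab] : exists2 b, A b & enorm (a1 - a2) / 2 <= enorm (b - a).
  have [?|?] := leP (enorm (a1 - a2) / 2) (enorm (a1 - a)); first by exists a1.
  by exists a2 => //; have := enorm_triangle a a1 a2; rewrite (enormB a a2); lra.
have bfar : far_from a e l h b.
  move=> s /andP[s0 sl]; have := s_a b s s0; have := s_u b s sl.
  have := near_u b Ab; rewrite -/l; lra.
have toball x : unit_ball x -> enorm x < 1 by rewrite unit_ballE.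
have [Kv [cKv coKv KvB Kvfar [Kvv [pv Kpv pvh]]]] :=
  escape_continuum n2 e1 l0 (Ak a Aa) k1 h0 hk (toball _ Bv) vfar.
have [Kb [cKb coKb KbB Kbfar [Kbb [pb Kpb pbh]]]] :=
  escape_continuum n2 e1 l0 (Ak a Aa) k1 h0 hk (toball _ (AB _ Ab)) bfar.
(* From [v] to the half-space ahead of [a], across it, and back to the point [b] of [A]. *)
exists (segment u a), (Kv `|` (segment pv pb `|` Kb)); split.
- split.
  + by apply: compact_closed; [exact: norm_hausdorff | exact: segment_compact].
  + exact: segment_connected.
  + by apply: segment_unit_ball => //; exact: AB.
  + by exists a; split => //; exact: segment_right.
  + exact: segment_left.
- split.
  + apply: compact_closed; first exact: norm_hausdorff.
    by apply: compactU => //; apply: compactU => //; exact: segment_compact.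
  + apply: connectedU => //.
      by exists pv; split => //; left; exact: segment_left.
    apply: connectedU => //; last exact: segment_connected.
    by exists pb; split => //; exact: segment_right.
  + rewrite !subUset; split => //; split => //.
    by apply: segment_unit_ball; [exact: KvB | exact: KbB].
  + by exists b; split => //; right; right.
  + by left.
move=> x y [t + <-] K2y; rewrite /= in_itv/= => /andP[t0 t1].
have yfar : far_from a e l (h / 8) y.
  case: K2y => [|[K2y|]]; [exact: Kvfar | | exact: Kbfar].
  by apply: far_from_ahead => //; exact: dot_segment_ge K2y.
have := yfar ((1 - t) * l); rewrite mulr_ge0 ?subr_ge0//= => /(_ _).
rewrite enormB (_ : a - _ *: e = u + t *: (a - u)); last first.
  by rewrite eE uE; apply/rowP => i; rewrite !mxE; ring.
by apply; rewrite ler_piMl//; lra.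
Qed.

(** The straight segment is drawn from whichever of [u] and [v] is nearer to [A]; the other one is
    then at least as far from [A] as the segment is long. The bound [h0] comes from two distinct
    points of [A] and from the distance of [A] to the sphere. *)
Lemma separating_continua A : (2 <= n)%N -> A `<=` unit_ball -> nondegenerate_continuum A ->
  exists2 h0 : R, 0 < h0 & forall u v, unit_ball u -> unit_ball v -> u != v ->
  exists K1 K2, [/\ continuum_to A u K1, continuum_to A v K2 &
    forall x y, K1 x -> K2 y -> Num.min (enorm (u - v) / 2) h0 / 8 <= enorm (x - y)].
Proof.
move=> n2 AB [cA _ [a1 [a2 [Aa1 Aa2 a12]]]].
have A0 : A !=set0 by exists a1.
have [c Ac cmax] := @EVT_max_rV R n (@enorm R n) A A0 cA
  (continuous_subspaceT (@continuous_enorm R n)).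
rewrite inE in Ac; have c1 : enorm c < 1 by have := AB _ Ac; rewrite unit_ballE.
pose kappa := 1 - enorm c.
have Ak x : A x -> enorm x <= 1 - kappa.
  by rewrite /kappa opprB addrCA subrr addr0 => Ax; apply: cmax; rewrite inE.
have k1 : kappa <= 1 by rewrite /kappa gerBl enorm_ge0.
have k0 : 0 < kappa by rewrite /kappa subr_gt0.
have d0 : 0 < enorm (a1 - a2) by apply: enorm_gt0; rewrite subr_eq0; apply/eqP.
exists (Num.min (enorm (a1 - a2) / 4) (kappa / 8)).
  by rewrite lt_min !divr_gt0.
move=> u v Bu Bv uv.
have nearest w : exists2 a, A a & forall x, A x -> enorm (a - w) <= enorm (x - w).
  have [a Aa amin] := @EVT_min_rV R n (fun x => enorm (x - w)) A A0 cA
    (continuous_subspaceT (@continuous_edist R n w)).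
  by rewrite inE in Aa; exists a => // x Ax; apply: amin; rewrite inE.
have [a Aa anear] := nearest u; have [b Ab bnear] := nearest v.
set h := Num.min _ (Num.min _ _).
have uv0 : 0 < enorm (u - v) by apply: enorm_gt0; rewrite subr_eq0.
have h0 : 0 < h by rewrite !lt_min !divr_gt0.
have h1 : h <= enorm (u - v) / 2 by rewrite ge_min lexx.
have h2 : h <= enorm (a1 - a2) / 4 by rewrite !ge_min lexx orbT.
have h3 : h <= kappa / 8 by rewrite !ge_min lexx !orbT.
have h4 : 8 * h <= kappa by lra.
have [ab|/ltW ba] := leP (enorm (a - u)) (enorm (b - v)).
  apply: (@separating_continua_nearest A a1 a2 a u v kappa h) => //.
  by move=> x Ax; exact: le_trans ab (bnear x Ax).
have h1' : h <= enorm (v - u) / 2 by rewrite enormB.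
have [K2 [K1 [cK2 cK1 K12]]] : exists K2 K1, [/\ continuum_to A v K2, continuum_to A u K1 &
    forall x y, K2 x -> K1 y -> h / 8 <= enorm (x - y)].
  apply: (@separating_continua_nearest A a1 a2 b v u kappa h) => //.
  by move=> x Ax; exact: le_trans ba (anear x Ax).
by exists K1, K2; split => // x y K1x K2y; rewrite enormB; exact: K12.
Qed.

End SeparatingContinuaInBall.

(** * Comparison of the two bounds for the modulus *)

Section KeyEstimate.
Context {R : realType} {m : nat}.
Local Notation n := m.+1.
Implicit Types (A : set 'rV[R]_n) (Q : 'rV[R]_n -> \bar R) (f F : 'rV[R]_n -> 'rV[R]_n).

Lemma edist_frontier (delta : R) (S : set 'rV[R]_n) (x0 w : 'rV[R]_n) :
  (delta%:E <= Defs.edist S (frontier unit_ball))%E -> frontier unit_ball x0 -> S w ->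
  delta <= enorm (w - x0).
Proof.
move=> h fx0 Sw; rewrite -lee_fin; apply: le_trans h _.
by apply: ereal_inf_lbound; exists (w, x0).
Qed.

Lemma segment_integral_ge0 (rho : 'rV[R]_n -> \bar R) (p z : 'rV[R]_n) :
  (forall x, 0 <= rho x)%E -> (0 <= segment_integral rho p z)%E.
Proof.
move=> rho0; rewrite /segment_integral mule_ge0//; first by rewrite lee_fin enorm_ge0.
exact: integral_ge0.
Qed.

(** As [f (p r)] and [f (q r)] are [2 * eta] apart, [f z] is at distance at least [eta] from one of
    them. So for each [z] one of the two segments is in the family, and its integral alone is at
    least 1. *)
Lemma modulus_separated_segments_ge (c eta a b : R) f (x0 : 'rV[R]_n) (p q : R -> 'rV[R]_n) :
  (forall (rho : 'rV[R]_n -> \bar R),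
    borel_fun rho -> (forall x, 0 <= rho x)%E ->
    (forall r z, a <= r <= b -> enorm z < 1 ->
      (1 <= segment_integral rho (p r) z + segment_integral rho (q r) z)%E) ->
    (c%:E <= \int[@leb R n]_x rho x ^+ n)%E) ->
  0 < eta ->
  (forall r, a <= r <= b -> [/\ unit_ball (p r), unit_ball (q r) &
     2 * eta <= enorm (f (p r) - f (q r))]) ->
  (c%:E <= modulus (separated_segments f eta))%E.
Proof.
move=> lower eta0 pq; apply: le_ereal_inf_tmp => _ [rho [rho0 mrho adm] <-].
have seg u z : unit_ball u -> unit_ball z -> eta <= enorm (f z - f u) ->
    (1 <= segment_integral rho u z)%E.
  move=> Bu Bz h; have uz : z - u != 0.
    by rewrite subr_eq0; apply: contraTneq h => ->; rewrite subrr enorm0 -ltNge.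
  apply: le_trans (path_integral_affine u mrho rho0 uz).
  apply: adm; first by exists u, z.
  move=> [s t] [_ _ /= st]; by rewrite curve_length_affine// ltry.
apply: lower => // r z rab z1; have [Bp Bq sep] := pq r rab.
have Bz : unit_ball z by rewrite unit_ballE.
have [hp|hp] := leP eta (enorm (f z - f (p r))).
  apply: le_trans (seg _ _ Bp Bz hp) _.
  by rewrite leeDl// segment_integral_ge0.
have hq : eta <= enorm (f z - f (q r)).
  have := enorm_triangle (f z) (f (p r)) (f (q r)).
  rewrite (enormB (f (p r)) (f z)); lra.
apply: le_trans (seg _ _ Bq Bz hq) _.
by rewrite leeDr// segment_integral_ge0.
Qed.

Lemma log_estimate : exists2 c : R, 0 < c & forall (delta h0 a b : R) A Q f (x0 x y : 'rV[R]_n),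
  (forall x, unit_ball x -> (0 <= Q x)%E) ->
  (@leb R n).-integrable unit_ball Q ->
  class_S delta A Q f -> frontier unit_ball x0 -> 0 < h0 ->
  (forall u v, unit_ball u -> unit_ball v -> u != v ->
    exists K1 K2, [/\ continuum_to A u K1, continuum_to A v K2 &
    forall x y, K1 x -> K2 y -> Num.min (enorm (u - v) / 2) h0 / 8 <= enorm (x - y)]) ->
  0 < a -> a < b -> b <= 1 -> b <= delta ->
  unit_ball x -> enorm (x - x0) < a -> unit_ball y -> enorm (y - x0) < a -> f x != f y ->
  c * ln (b / a) <= L1_norm unit_ball Q / (Num.min (enorm (f x - f y) / 2) h0 / 16) ^+ n.
Proof.
have [c c0 lower] := @modulus_log_lower_bound R m; exists c => //.
move=> delta h0 a b A Q f x0 x y Q0 iQ [[cf fB of_ _ clf] [fQ far]] fx0 h00 sep.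
move=> a0 ab b1 bd Bx xa By ya fxy.
have fBB w : unit_ball w -> unit_ball (f w) by move=> Bw; rewrite -fB; exists w.
have [K1 [K2 [K1P K2P K12]]] := sep _ _ (fBB x Bx) (fBB y By) fxy.
set h := Num.min _ _ in K12 *.
have h_gt0 : 0 < h.
  by rewrite lt_min h00 andbT divr_gt0// enorm_gt0// subr_eq0.
have meets K w : continuum_to A (f w) K -> unit_ball w -> enorm (w - x0) < a ->
    exists p : R -> 'rV[R]_n, forall r, a <= r <= b ->
      [/\ unit_ball (p r), enorm (p r - x0) = r & K (f (p r))].
  move=> [clK coK KB KA Kw] Bw wa.
  suff /choice[p pP] : forall r, exists p, a <= r <= b ->
    [/\ unit_ball p, enorm (p - x0) = r & K (f p)] by exists p.
  move=> r; have [/andP[ar rb]|nr] := boolP (a <= r <= b); last by exists 0.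
  have farr u : unit_ball u -> A (f u) -> r <= enorm (u - x0).
    move=> Bu Au; apply: (le_trans rb); apply: (le_trans bd).
    exact: (edist_frontier far fx0).
  have [p ?] := preimage_meets_sphere cf of_ clf coK clK KB KA Bw Kw (lt_le_trans wa ar) farr.
  by exists p.
have [p pP] := meets K1 x K1P Bx xa; have [q qP] := meets K2 y K2P By ya.
have x01 := frontier_enorm fx0.
(* [K1] and [K2] are at distance at least [h / 8], which has to be [2 * eta]. *)
rewrite -lee_fin; have eta0 : 0 < h / 16 by rewrite divr_gt0.
apply: le_trans (modulus_separated_segments_le eta0 fB fQ Q0 iQ).
apply: (@modulus_separated_segments_ge _ _ a b f x0 p q) => //.
  move=> rho mrho rho0 H; apply: (lower x0 p q) => // r rab.
  have [Bp pr _] := pP r rab; have [Bq qr _] := qP r rab.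
  by rewrite -!unit_ballE.
move=> r rab; have [Bp pr Kp] := pP r rab; have [Bq qr Kq] := qP r rab.
by split => //; have := K12 _ _ Kp Kq; lra.
Qed.

End KeyEstimate.

(** * Extension by limits to the closure *)

Section BoundaryLimits.
Context {R : realType} {n : nat}.
Implicit Types (B : set 'rV[R]_n) (f F : 'rV[R]_n -> 'rV[R]_n) (x L : 'rV[R]_n).

(** The point [x] is not excluded, so for [x] in [B] the limit can only be [f x]. *)
Definition elim_within B f x L : Prop := forall e : R, 0 < e ->
  exists2 t : R, 0 < t & forall y, B y -> enorm (y - x) < t -> enorm (f y - L) < e.

Lemma elim_withinP B f x L : f @ within B (nbhs x) --> L <-> elim_within B f x L.
Proof.
split=> [fL e e0|fL U].
  have /fL : nbhs L (eball L e) by exact: nbhs_eball.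
  by move=> /nbhs_eballP[t t0 tP]; exists t => // y By /tP; exact.
move=> /nbhs_eballP[e e0 eU]; have [t t0 tP] := fL e e0.
by apply/nbhs_eballP; exists t => // y yx By; apply: eU; exact: tP.
Qed.

Lemma within_continuous_elim B f :
  {within B, continuous f} <-> forall x, B x -> elim_within B f x (f x).
Proof.
split=> [/subspace_continuousP h x Bx|h].
  by apply/elim_withinP; exact: h.
by apply/subspace_continuousP => x Bx; apply/elim_withinP; exact: h.
Qed.

Lemma closure_eball B x t : closure B x -> 0 < t -> exists2 y, B y & enorm (y - x) < t.
Proof. by move=> cx t0; have [y [By yx]] := cx _ (nbhs_eball x t0); exists y. Qed.

Lemma elim_within_cauchy B f x : closure B x ->
  (forall e : R, 0 < e -> exists2 t : R, 0 < t &
    forall y z, B y -> B z -> enorm (y - x) < t -> enorm (z - x) < t -> enorm (f y - f z) <= e) ->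
  exists L, elim_within B f x L.
Proof.
move=> cx osc; pose G := f @ within B (nbhs x).
have GF : ProperFilter G by apply: fmap_proper_filter.
have : cauchy G.
  apply: cauchy_exP => e e0.
  have e2 : 0 < e / 2 by rewrite divr_gt0.
  have [t t0 tP] := osc _ e2; have [y By yx] := closure_eball cx t0.
  exists (f y); apply/nbhs_eballP; exists t => // z zx Bz.
  rewrite mx_norm_ball/= /ball_/=; apply: le_lt_trans (norm_le_enorm _) _.
  by have := tP y z By Bz yx zx; lra.
move=> /cauchy_cvg/cvg_ex[L GL]; exists L; exact/elim_withinP.
Qed.

Lemma elim_within_extension B f : {within B, continuous f} ->
  (forall x, closure B x -> ~ B x -> exists L, elim_within B f x L) ->
  exists F, [/\ {within closure B, continuous F}, F @` closure B `<=` closure (f @` B) &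
    {in B, F =1 f}].
Proof.
move=> /within_continuous_elim cf lim.
have /choice[F FP] : forall x, exists L, closure B x ->
    (B x -> L = f x) /\ elim_within B f x L.
  move=> x; have [Bx|nBx] := pselect (B x).
    by exists (f x) => _; split => //; exact: cf.
  have [cx|ncx] := pselect (closure B x); last by exists 0.
  by have [L ?] := lim x cx nBx; exists L.
exists F; split.
- apply/within_continuous_elim => x cx e e0.
  have e2 : 0 < e / 2 by rewrite divr_gt0.
  have [_ Fx] := FP x cx; have [t t0 tP] := Fx _ e2; exists t => // y cy yx.
  have [_ Fy] := FP y cy; have [s s0 sP] := Fy _ e2.
  (* A point [z] of [B] this close to [y] is still within [t] of [x], so [f z] is near both [F y]
     and [F x]. *)
  have st0 : 0 < Num.min s (t - enorm (y - x)) by rewrite lt_min s0 subr_gt0.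
  have [z Bz] := closure_eball cy st0; rewrite lt_min => /andP[zs zt].
  have zx : enorm (z - x) < t by have := enorm_triangle y z x; lra.
  have := enorm_triangle (f z) (F y) (F x); rewrite (enormB (F y) (f z)).
  have := tP z Bz zx; have := sP z Bz zs; lra.
- move=> _ [x cx <-] U /nbhs_eballP[e e0 eU].
  have [_ Fx] := FP x cx; have [t t0 tP] := Fx _ e0.
  have [y By yx] := closure_eball cx t0.
  by exists (f y); split; [exists y | apply: eU; exact: tP].
- by move=> x; rewrite inE => Bx; have [->//] := FP x (subset_closure Bx).
Qed.

End BoundaryLimits.

(** * The modulus of continuity at the boundary and the theorem *)

Lemma root_bound {R : realType} (m : nat) (c l E L : R) : 0 < c -> 0 < l -> 0 <= E -> 0 <= L ->
  c * l * (E / 32) ^+ m.+1 <= L ->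
  E <= 32 / c `^ m.+1%:R^-1 * (L `^ m.+1%:R^-1) / (l `^ m.+1%:R^-1).
Proof.
move=> c0 l0 E0 L0 h; set al := m.+1%:R^-1.
have al0 : 0 <= al by rewrite invr_ge0.
have E32 : 0 <= E / 32 by rewrite divr_ge0.
have ca : 0 < c `^ al by exact: powR_gt0.
have la : 0 < l `^ al by exact: powR_gt0.
have : c `^ al * l `^ al * (E / 32) <= L `^ al.
  have <- : ((E / 32) ^+ m.+1) `^ al = E / 32.
    by rewrite -powR_mulrn// -powRrM mulfV ?pnatr_eq0// powRr1.
  rewrite -!powRM ?mulr_ge0 ?exprn_ge0 ?(ltW c0) ?(ltW l0)//.
  apply: ge0_ler_powR => //; rewrite nnegrE// !mulr_ge0 ?exprn_ge0 ?(ltW c0) ?(ltW l0)//.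
move=> h2; rewrite ler_pdivlMr// mulrAC ler_pdivlMr//.
have := ler_wpM2l (ler0n R 32) h2.
rewrite (_ : 32 * (c `^ al * l `^ al * (E / 32)) = E * l `^ al * c `^ al) //.
by field.
Qed.

Lemma boundary_modulus_of_continuity {R : realType} (m : nat) : (2 <= m.+1)%N ->
  exists2 c : R, 0 < c & forall (delta : R) (A : set 'rV[R]_m.+1) (Q : 'rV[R]_m.+1 -> \bar R),
  0 < delta -> A `<=` unit_ball -> nondegenerate_continuum A ->
  (forall x, unit_ball x -> (0 <= Q x)%E) -> (@leb R m.+1).-integrable unit_ball Q ->
  exists a0 b, [/\ 0 < a0, a0 < b & forall f x0 a x y, class_S delta A Q f ->
    frontier unit_ball x0 -> 0 < a <= a0 ->
    unit_ball x -> enorm (x - x0) < a -> unit_ball y -> enorm (y - x0) < a ->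
    c * ln (b / a) * (enorm (f x - f y) / 32) ^+ m.+1 <= L1_norm unit_ball Q].
Proof.
move=> n2; have [c c0 est] := @log_estimate R m; exists c => //.
move=> delta A Q d0 AB ncA Q0 iQ.
have [h0 h00 sep] := separating_continua n2 AB ncA.
(* Open balls about [x0] of radius at most [delta] miss the preimage of [A], and radii at most 1
   keep the cubes in the unit ball. *)
pose b := Num.min delta 1; have b0 : 0 < b by rewrite lt_min d0 ltr01.
have L0 : 0 <= L1_norm unit_ball Q by rewrite /L1_norm fine_ge0// integral_ge0.
(* The right-hand side of [log_estimate] if the minimum there is [h0]. The choice of [a0] makes
   [c * ln (b / a) >= T + c] for [a <= a0], which excludes that case; otherwise the factors 2 and 16
   combine to 32. *)
pose T := L1_norm unit_ball Q / (h0 / 16) ^+ m.+1.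
have T0 : 0 <= T by rewrite divr_ge0// exprn_ge0// divr_ge0// ltW.
have Tc : 0 < T / c + 1 by rewrite ltr_wpDl// divr_ge0// ltW.
pose a0 := b * expR (- (T / c + 1)).
have a00 : 0 < a0 by rewrite mulr_gt0 ?expR_gt0.
have a0b : a0 < b by rewrite -[ltRHS]mulr1 ltr_pM2l// expR_lt1 oppr_lt0.
exists a0, b; split => // f x0 a x y Sf fx0 /andP[ap aa0] Bx xa By ya.
have ab : a < b := le_lt_trans aa0 a0b.
have [->|fxy] := eqVneq (f x) (f y).
  by rewrite subrr enorm0 mul0r expr0n mulr0.
have E0 : 0 < enorm (f x - f y) by rewrite enorm_gt0// subr_eq0.
have := est delta h0 a b A Q f x0 x y Q0 iQ Sf fx0 h00 sep ap ab _ _ Bx xa By ya fxy.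
rewrite !ge_min !lexx orbT => /(_ isT isT).
have lnT : T / c + 1 <= ln (b / a).
  rewrite -[leLHS]expRK ler_ln ?posrE ?expR_gt0 ?divr_gt0//.
  rewrite ler_pdivlMr// mulrC -ler_pdivlMr ?expR_gt0//.
  by rewrite -expRN.
have [h|h] := leP (enorm (f x - f y) / 2) h0.
  rewrite ler_pdivlMr ?exprn_gt0 ?divr_gt0//.
  by rewrite (_ : _ / 2 / 16 = enorm (f x - f y) / 32)//; field.
rewrite -/T => h1; exfalso.
have := ler_wpM2l (ltW c0) lnT; rewrite mulrDr mulrCA mulfV ?gt_eqF// !mulr1; lra.
Qed.

(** Since [ln (b / a)] is unbounded as [a] tends to 0, the oscillation of [f] near a boundary point
    tends to 0, and completeness gives a limit. *)
Lemma class_S_extension {R : realType} (m : nat) (delta : R) (A : set 'rV[R]_m.+1)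
    (Q : 'rV[R]_m.+1 -> \bar R) : (2 <= m.+1)%N ->
  0 < delta -> A `<=` unit_ball -> nondegenerate_continuum A ->
  (forall x, unit_ball x -> (0 <= Q x)%E) -> (@leb R m.+1).-integrable unit_ball Q ->
  forall f, class_S delta A Q f -> exists F, is_extension f F.
Proof.
move=> n2 d0 AB ncA Q0 iQ f Sf.
have [c c0 est] := @boundary_modulus_of_continuity R m n2.
have [a0 [b [a00 a0b H]]] := est delta A Q d0 AB ncA Q0 iQ.
have L0 : 0 <= L1_norm unit_ball Q by rewrite /L1_norm fine_ge0// integral_ge0.
have [[cf fB _ _ _] _] := Sf.
suff lim x0 : closure unit_ball x0 -> ~ unit_ball x0 -> exists L, elim_within unit_ball f x0 L.
  have [F [cF FB Ff]] := elim_within_extension cf lim.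
  by exists F; split => //; rewrite fB in FB.
move=> cx0 nBx0; have fx0 : frontier unit_ball x0 by apply/frontier_unit_ball.
apply: elim_within_cauchy => // e e0.
have b0 : 0 < b := lt_trans a00 a0b.
(* With [ln (b / a) >= T + 1], images more than [e] apart would make the left side of the estimate
   exceed the norm of [Q]. *)
pose T := L1_norm unit_ball Q / (c * (e / 32) ^+ m.+1).
have ce : 0 < c * (e / 32) ^+ m.+1 by rewrite mulr_gt0// exprn_gt0// divr_gt0.
have T0 : 0 <= T by rewrite divr_ge0// ltW.
pose a := Num.min a0 (b * expR (- (T + 1))).
have ap : 0 < a by rewrite lt_min a00 mulr_gt0// expR_gt0.
exists a => // y z By Bz ya za; rewrite leNgt; apply/negP => ez.
have := H f x0 a y z Sf fx0; rewrite ap ge_min lexx => /(_ isT By ya Bz za).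
apply/negP; rewrite -ltNge.
have lnT : T + 1 <= ln (b / a).
  rewrite -[leLHS]expRK ler_ln ?posrE ?expR_gt0 ?divr_gt0//.
  rewrite ler_pdivlMr// mulrC -ler_pdivlMr ?expR_gt0// -expRN.
  by rewrite ge_min lexx orbT.
apply: (@lt_le_trans _ _ (c * (T + 1) * (e / 32) ^+ m.+1)).
  rewrite mulrAC mulrDr mulr1 /T mulrCA mulfV ?gt_eqF// mulr1.
  by rewrite ltrDl.
apply: ler_pM; rewrite ?exprn_ge0 ?mulr_ge0 ?divr_ge0 ?(ltW c0) ?(ltW e0) ?addr_ge0//.
  by rewrite ler_wpM2l// ltW.
by rewrite lerXn2r ?nnegrE ?divr_ge0 ?enorm_ge0 ?(ltW e0)// ler_wpM2r// ltW.
Qed.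

Theorem theorem1p1 (R : realType) (n : nat) (n_ge2 : (2 <= n)%N) :
  (forall (delta : R) (A : set 'rV[R]_n) (Q : 'rV[R]_n -> \bar R),
     0 < delta -> A `<=` unit_ball -> nondegenerate_continuum A ->
     (forall x, unit_ball x -> (0 <= Q x)%E) ->
     (@leb R n).-integrable unit_ball Q ->
     forall f, class_S delta A Q f -> exists F, is_extension f F) /\
  (exists C : R, 0 < C /\
   forall (delta : R) (A : set 'rV[R]_n) (Q : 'rV[R]_n -> \bar R),
     0 < delta -> A `<=` unit_ball -> nondegenerate_continuum A ->
     (forall x, unit_ball x -> (0 <= Q x)%E) ->
     (@leb R n).-integrable unit_ball Q ->
     forall x0, frontier unit_ball x0 ->
     exists r0 : R, 0 < r0 /\
     forall f F, class_S delta A Q f -> is_extension f F ->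
     forall x, eball x0 r0 x -> closure unit_ball x ->
       enorm (F x - F x0) <=
         if x == x0 then 0 else
           C * (L1_norm unit_ball Q `^ n%:R^-1) /
             (ln (1 + r0 / enorm (x - x0)) `^ n%:R^-1)).
Proof.
case: n n_ge2 => [//|m] n_ge2; split.
  by move=> delta A Q d0 AB ncA Q0 iQ; exact: class_S_extension.
have [c c0 est] := @boundary_modulus_of_continuity R m n_ge2.
exists (32 / c `^ m.+1%:R^-1); split; first by rewrite divr_gt0// powR_gt0.
move=> delta A Q d0 AB ncA Q0 iQ x0 fx0.
have [a0 [b [a00 a0b H]]] := est delta A Q d0 AB ncA Q0 iQ.
have L0 : 0 <= L1_norm unit_ball Q by rewrite /L1_norm fine_ge0// integral_ge0.
(* With [s = |x - x0| < a0 / 4] the estimate is applied at [a = 2 * s <= a0]; then [2 * s * (1 + (a0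
   / 4) / s) = 2 * s + a0 / 2 <= b] gives the stated logarithm. *)
exists (a0 / 4); split; first by rewrite divr_gt0.
move=> f F Sf [cF _ Ff] x xr cx; have [->|xx0] := eqVneq x x0.
  by rewrite subrr enorm0.
have s0 : 0 < enorm (x - x0) by rewrite enorm_gt0// subr_eq0.
have sr : enorm (x - x0) < a0 / 4 by [].
set s := enorm (x - x0) in s0 sr *.
have b0 : 0 < b := lt_trans a00 a0b.
have arg : 1 + a0 / 4 / s <= b / (2 * s).
  rewrite ler_pdivlMr ?mulr_gt0// mulrDl mul1r mulrCA divfK ?gt_eqF//; lra.
have arg1 : 1 < 1 + a0 / 4 / s by rewrite ltrDl !divr_gt0.
(* The estimate is available inside the ball only: [x] and [x0] are replaced by points of the ball
   whose images are within [e / 2] of [F x] and [F x0]. The radius [2 * s] leaves room for them. *)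
apply/ler_addgt0Pr => e e0; have e2 : 0 < e / 2 by rewrite divr_gt0.
have [cx0 _] := (frontier_unit_ball x0).1 fx0.
move/within_continuous_elim : cF => cF.
have near u : closure unit_ball u -> enorm (u - x0) < 2 * s ->
    exists v, [/\ unit_ball v, enorm (v - x0) < 2 * s & enorm (f v - F u) < e / 2].
  move=> cu us; have [t t0 tP] := cF u cu _ e2.
  have t0' : 0 < Num.min t (2 * s - enorm (u - x0)) by rewrite lt_min t0 subr_gt0.
  have [v Bv] := closure_eball cu t0'; rewrite lt_min => /andP[vt vs]; exists v; split => //.
    by have := enorm_triangle u v x0; lra.
  by rewrite -Ff ?inE//; apply: tP => //; exact: subset_closure.
have [|x' [Bx xs xF]] := near x cx; first by rewrite -/s; lra.
have [|y' [By ys yF]] := near x0 cx0; first by rewrite subrr enorm0 mulr_gt0.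
have := H f x0 (2 * s) x' y' Sf fx0; rewrite mulr_gt0//=.
have -> : 2 * s <= a0 by lra.
move=> /(_ isT Bx xs By ys) est'.
have : c * ln (1 + a0 / 4 / s) * (enorm (f x' - f y') / 32) ^+ m.+1 <= L1_norm unit_ball Q.
  apply: le_trans est'; rewrite ler_wpM2r ?exprn_ge0 ?divr_ge0 ?enorm_ge0//.
  rewrite ler_wpM2l ?(ltW c0)// ler_ln ?posrE// ?divr_gt0 ?mulr_gt0//.
  exact: lt_trans arg1.
move=> /(root_bound c0 (ln_gt0 arg1) (enorm_ge0 _) L0) fin.
have := enorm_triangle (f x') (F x) (F x0).
have := enorm_triangle (f y') (f x') (F x0).
rewrite (enormB (F x) (f x')); lra.
Qed.
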